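(* For every $k\ge 3$, the diamond $\mathbf{M}_k$ is well-characterised; that is, there is a deterministic verification procedure which receives a positive integer $n$, value-oracle access to a function $f:\mathbf{M}_k^n\to\mathbb{Z}$ that is promised to be submodular, an integer $m$, and a candidate certificate, runs in time polynomial in $n$ and $\max_{\mathbf{t}\in\mathbf{M}_k^n}\log|f(\mathbf{t})|$, and satisfies: (completeness) if $\min_{\mathbf{t}\in\mathbf{M}_k^n} f(\mathbf{t})=m$, then some certificate is accepted; (soundness) if some certificate is accepted, then $\min_{\mathbf{t}\in\mathbf{M}_k^n} f(\mathbf{t})=m$.
   Context: $\mathbf{M}_k$ denotes the diamond with $k$ atoms: its elements are a bottom $0_M$, a top $1_M$, and a set $A$ of $k$ atoms, with $0_M<a<1_M$ for all $a\in A$ and distinct atoms incomparable. $\mathbf{M}_k^n$ is the product lattice with coordinatewise order, meet and join. A function $f:\mathbf{M}_k^n\to\mathbb{R}$ is submodular if $f(\mathbf{s}\wedge\mathbf{t})+f(\mathbf{s}\vee\mathbf{t})\le f(\mathbf{s})+f(\mathbf{t})$ for all $\mathbf{s},\mathbf{t}$. A value oracle for $f$ returns $f(\mathbf{t})$ when queried with $\mathbf{t}$. *)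

(* Defs.v *)
From HB Require Import structures.
From mathcomp Require Import all_boot all_order all_algebra.

Set Implicit Arguments.
Unset Strict Implicit.
Unset Printing Implicit Defensive.

Import Order.TTheory GRing.Theory Num.Theory.
Local Open Scope ring_scope.

Inductive diamond (k : nat) : Type := DBot | DTop | DAtom of 'I_k.
Arguments DBot {k}.
Arguments DTop {k}.

Section DiamondLattice.
Variable k : nat.
Implicit Types x y z : diamond k.

Definition diamond_code x : option (option 'I_k) :=
  match x with DBot => None | DTop => Some None | DAtom a => Some (Some a) end.
Definition diamond_decode (c : option (option 'I_k)) : diamond k :=
  match c with None => DBot | Some None => DTop | Some (Some a) => DAtom a end.
Lemma diamond_codeK : cancel diamond_code diamond_decode.
Proof. by case. Qed.

HB.instance Definition _ := Finite.copy (diamond k) (can_type diamond_codeK).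

Definition diamond_le x y : bool :=
  match x, y with
  | DBot, _ => true
  | _, DTop => true
  | DAtom a, DAtom b => a == b
  | _, _ => false
  end.

Definition diamond_meet x y : diamond k :=
  match x, y with
  | DBot, _ | _, DBot => DBot
  | DTop, z | z, DTop => z
  | DAtom a, DAtom b => if a == b then DAtom a else DBot
  end.

Definition diamond_join x y : diamond k :=
  match x, y with
  | DTop, _ | _, DTop => DTop
  | DBot, z | z, DBot => z
  | DAtom a, DAtom b => if a == b then DAtom a else DTop
  end.

Fact diamond_le_refl : reflexive diamond_le.
Proof. by case=> //= a. Qed.

Fact diamond_le_anti : antisymmetric diamond_le.
Proof. by move=> [||a] [||b] //= /andP[/eqP->]. Qed.

Fact diamond_le_trans : transitive diamond_le.
Proof. by move=> [||b] [||a] [||c] //= /eqP->. Qed.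

Fact diamond_display : Order.disp_t.
Proof. exact: Order.Disp tt tt. Qed.

HB.instance Definition _ := Order.Le_isPOrder.Build diamond_display (diamond k)
  diamond_le_refl diamond_le_anti diamond_le_trans.

Fact diamond_lexI x y z :
  (x <= diamond_meet y z)%O = (x <= y)%O && (x <= z)%O.
Proof.
rewrite /Order.le /=; move: x y z => [||a] [||b] [||c] //=;
  rewrite ?andbT ?andbF //; case: (b =P c) => [?|bc] //=; subst; rewrite ?andbb //.
by apply/esym/negbTE/andP => -[/eqP ab /eqP ac]; apply: bc; rewrite -ab -ac.
Qed.

Fact diamond_leUx x y z :
  (diamond_join x y <= z)%O = (x <= z)%O && (y <= z)%O.
Proof.
rewrite /Order.le /=; move: x y z => [||a] [||b] [||c] //=;
  rewrite ?andbT ?andbF //; case: (a =P b) => [?|ab] //=; subst; rewrite ?andbb //.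
by apply/esym/negbTE/andP => -[/eqP ac /eqP bc]; apply: ab; rewrite ac bc.
Qed.

HB.instance Definition _ := Order.POrder_MeetJoin_isLattice.Build
  diamond_display (diamond k) diamond_lexI diamond_leUx.

Fact diamond_le0x x : (DBot <= x)%O.
Proof. by []. Qed.

Fact diamond_lex1 x : (x <= DTop)%O.
Proof. by case: x. Qed.

HB.instance Definition _ :=
  Order.hasBottom.Build diamond_display (diamond k) diamond_le0x.
HB.instance Definition _ :=
  Order.hasTop.Build diamond_display (diamond k) diamond_lex1.

End DiamondLattice.

Definition submodular (d : Order.disp_t) (L : latticeType d)
    (R : numDomainType) (f : L -> R) : Prop :=
  forall s t : L, f (s `&` t)%O + f (s `|` t)%O <= f s + f t.

Definition is_minimum (T : Type) (d : Order.disp_t) (R : porderType d)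
    (f : T -> R) (m : R) : Prop :=
  (exists t, f t = m) /\ (forall t, (m <= f t)%O).

(*  Random-access machines with logarithmic (bit-length) cost, presented as
    structured programs.  The memory consists of countably many integer arrays,
    of which a program names only finitely many; a scalar is cell 0 of an
    array.  Every elementary step is charged the bit lengths of all integers
    involved, addresses included, and no operation yields a result longer than
    one plus the sum of the lengths of its operands: this makes the model
    polynomially equivalent to multitape oracle Turing machines. *)

Definition bitlen (z : int) : nat := (trunc_log 2 `|z|%N).+1.

Inductive binop := OpAdd | OpSub | OpMul | OpDiv | OpMod | OpLe | OpEq.

Inductive expr :=
  | Const of int
  | Get of nat & expr             (* Get x e is the cell x[e] *)
  | Bin of binop & expr & expr.

Inductive cmd :=
  | Skip
  | Set_ of nat & expr & expr     (* Set_ x e1 e2 is x[e1] := e2 *)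
  | Seq of cmd & cmd
  | If of expr & cmd & cmd        (* every nonzero integer counts as true *)
  | While of expr & cmd
  | Query of nat & nat.           (* Query x a is x[0] := f(a[0], ..., a[n-1]) *)

Definition memory := nat -> int -> int.

Definition upd (s : memory) (x : nat) (i v : int) : memory :=
  fun y j => if (y == x) && (j == i) then v else s y j.

Definition binop_eval (o : binop) (u v : int) : int :=
  match o with
  | OpAdd => u + v
  | OpSub => u - v
  | OpMul => u * v
  | OpDiv => (u %/ v)%Z
  | OpMod => (u %% v)%Z
  | OpLe => (nat_of_bool (u <= v)%R)%:Z
  | OpEq => (nat_of_bool (u == v)%R)%:Z
  end.

Fixpoint eval (s : memory) (e : expr) : int :=
  match e with
  | Const z => z
  | Get x e1 => s x (eval s e1)
  | Bin o e1 e2 => binop_eval o (eval s e1) (eval s e2)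
  end.

Fixpoint cost (s : memory) (e : expr) : nat :=
  match e with
  | Const z => bitlen z
  | Get _ e1 => cost s e1 + bitlen (eval s e1) + bitlen (eval s e)
  | Bin _ e1 e2 =>
      cost s e1 + cost s e2 + bitlen (eval s e1) + bitlen (eval s e2)
  end%N.

Section Semantics.
Variables (d : Order.disp_t) (L : finLatticeType d) (n : nat).
Variable f : n.-tupleprod L -> int.

(* Elements of L are represented by their ranks 0, ..., #|L| - 1. *)
Definition encodes (a : int -> int) (t : n.-tupleprod L) : Prop :=
  forall i : 'I_n, a (i : nat)%:Z = (enum_rank (tnth t i) : nat)%:Z.

(* exec c s s' T: started in memory s, the program c halts in memory s' after
   time T.  A query whose cells do not encode an element of L^n is stuck. *)
Inductive exec : cmd -> memory -> memory -> nat -> Prop :=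
  | exec_Skip s : exec Skip s s 1
  | exec_Set x e1 e2 s :
      exec (Set_ x e1 e2) s (upd s x (eval s e1) (eval s e2))
        (cost s e1 + cost s e2 + bitlen (eval s e1) + bitlen (eval s e2))
  | exec_Seq c1 c2 s s1 s2 T1 T2 :
      exec c1 s s1 T1 -> exec c2 s1 s2 T2 -> exec (Seq c1 c2) s s2 (T1 + T2)
  | exec_IfT e c1 c2 s s1 T :
      eval s e != 0 -> exec c1 s s1 T -> exec (If e c1 c2) s s1 (cost s e + T)
  | exec_IfF e c1 c2 s s1 T :
      eval s e = 0 -> exec c2 s s1 T -> exec (If e c1 c2) s s1 (cost s e + T)
  | exec_WhileT e c s s1 s2 T1 T2 :
      eval s e != 0 -> exec c s s1 T1 -> exec (While e c) s1 s2 T2 ->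
      exec (While e c) s s2 (cost s e + T1 + T2)
  | exec_WhileF e c s :
      eval s e = 0 -> exec (While e c) s s (cost s e)
  | exec_Query x a s t :
      encodes (s a) t ->
      exec (Query x a) s (upd s x 0 (f t)) (n + bitlen (f t)).

Lemma encodes_inj a t1 t2 : encodes a t1 -> encodes a t2 -> t1 = t2.
Proof.
move=> h1 h2; apply: eq_from_tnth => i.
by apply/enum_rank_inj/val_inj; have := h1 i; rewrite h2 => -[].
Qed.

Lemma exec_det c s s1 s2 T1 T2 :
  exec c s s1 T1 -> exec c s s2 T2 -> s1 = s2 /\ T1 = T2.
Proof.
move=> h; elim: h s2 T2 => {c s s1 T1}; intros;
  match goal with H : exec _ _ _ _ |- _ =>
    solve [inversion H; subst; repeat match goal with
    | IH : forall s2 T2, exec ?c ?s s2 T2 -> _, E : exec ?c ?s _ _ |- _ =>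
        case: (IH _ _ E) => ? ?; subst; clear E
    | N : is_true (?x != 0), E : ?x = 0 |- _ => by rewrite E eqxx in N
    | E1 : encodes _ ?t, E2 : encodes _ ?u |- _ =>
        have ? := encodes_inj E1 E2; subst; clear E1
    end; split=> //] end.
Qed.

End Semantics.

(* Sign, then the binary digits of the absolute value, least significant
   first. *)
Definition int_bits (z : int) : seq bool :=
  (z < 0) :: mkseq (fun i => odd (`|z|%N %/ 2 ^ i)) (bitlen z).

(* A bit string stored one bit per cell from address 0 on, -1 elsewhere. *)
Definition load (b : seq bool) (i : int) : int :=
  if i is Posz j then nth (-1) [seq (nat_of_bool x)%:Z | x <- b] j else -1.

(* m and the certificate are supplied bit by bit, so that a program need not
   pay for their full lengths, which the time bound does not control. *)
Definition init_memory (n : nat) (m : int) (cert : seq bool) : memory :=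
  fun x i =>
    match x with
    | 0%N => if i == 0 then n%:Z else 0
    | 1%N => load (int_bits m) i
    | 2%N => load cert i
    | _ => 0
    end.

Definition accepts (d : Order.disp_t) (L : finLatticeType d) (V : cmd)
    (n : nat) (f : n.-tupleprod L -> int) (m : int) (cert : seq bool) : Prop :=
  exists s T, exec f V (init_memory n m cert) s T /\ s 0%N 0 = 1.

(* The maximum of floor(log2 |f t|), with log 0 read as 0. *)
Definition max_log (d : Order.disp_t) (L : finLatticeType d) (n : nat)
    (f : n.-tupleprod L -> int) : nat :=
  (\max_(t : n.-tupleprod L) trunc_log 2 `|f t|)%N.

Definition well_characterised (d : Order.disp_t) (L : finLatticeType d) :
    Prop :=
  exists (V : cmd) (p : {poly {poly nat}}),
  forall (n : nat) (f : n.-tupleprod L -> int),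
    (0 < n)%N -> submodular f ->
    [/\ forall (m : int) (cert : seq bool), exists (s : memory) (T : nat),
          exec f V (init_memory n m cert) s T /\
          (T <= p.[n%:P].[max_log f])%N,
        forall m : int,
          is_minimum f m -> exists cert : seq bool, accepts V f m cert
      & forall m : int,
          (exists cert : seq bool, accepts V f m cert) -> is_minimum f m].

(* Main.v *)
Require Import Defs.
From mathcomp Require Import all_boot all_order all_algebra.
From mathcomp Require Import ring lra zify.

(** A maximal "chain" that raises one coordinate at a time from the bottom to
    the top of [M_k^n] yields a separable lower bound: if the coordinate goes
    from [x] to [y] at the point [c], submodularity applied to [t `&` c'] and
    [c] ([c'] the next point) shows that the telescoping term of [f t] is at
    least [f (c with x `|` (z `&` y)) - f c], where [z] is the coordinate of
    [t]. A certificate is a convex combination of such bounds together with a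
    minimiser; the minimum of a separable function is computed coordinatewise.

    That these bounds suffice is a matrix game between chains and points. By
    the theorem of the alternative it is enough to answer a distribution on
    points, and only its marginals [mu_i] matter. If an atom [p] carries more
    than half of the [mu_i]-mass of the atoms, the answering chain passes from
    the bottom to [p] at level [mu_i p + mu_i 1] and to the top at level
    [mu_i (atoms other than p) + mu_i 1]; otherwise it jumps to the top at
    level [mu_i 1 + mu_i (atoms) / 2]. Sweeping the levels downwards writes the
    expected bound as an average of values of [f].

    Caratheodory's theorem leaves at most [n (k + 2) + 1] chains, and since [f]
    is integer valued a bound exceeding [m - 1] is enough, so the weights can
    be rounded to polynomially many bits. *)

Set Implicit Arguments.
Unset Strict Implicit.
Unset Printing Implicit Defensive.
Import Order.TTheory GRing.Theory Num.Theory.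
Local Open Scope ring_scope.

(** * Linear inequalities *)

Section LinearInequalities.
Variable F : realFieldType.

(** All coefficients are positive and at least one generator occurs, so [pos_comb A 0] is a
    nontrivial positive dependence. *)
Inductive pos_comb (V : lmodType F) (A : V -> Prop) : V -> Prop :=
  | pos_comb_gen a : A a -> pos_comb A a
  | pos_comb_add u v : pos_comb A u -> pos_comb A v -> pos_comb A (u + v)
  | pos_comb_scale c v : 0 < c -> pos_comb A v -> pos_comb A (c *: v).

Lemma pos_comb_sub (V : lmodType F) (A B : V -> Prop) v :
  (forall a, A a -> pos_comb B a) -> pos_comb A v -> pos_comb B v.
Proof.
move=> AB; elim=> [a /AB //|u w _ + _ +|c w c0 _].
  exact: pos_comb_add.
exact: pos_comb_scale.
Qed.

Lemma pos_comb_coeffs (V : lmodType F) (I : finType) (g : I -> V) v :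
  pos_comb (fun a => exists i, a = g i) v ->
  exists c : I -> F, [/\ forall i, 0 <= c i, exists i, 0 < c i
    & v = \sum_i c i *: g i].
Proof.
elim=> [_ [i ->]|u w _ [c [c0 [i ci] ->]] _ [e [e0 _ ->]]|r w r0 _ [c [c0 [i ci] ->]]].
- exists (fun l => (l == i)%:R); split=> [l|//|].
  + by rewrite ler0n.
  + by exists i; rewrite eqxx ltr01.
  + rewrite (bigD1 i) //= eqxx scale1r big1 ?addr0 // => l /negPf ->.
    by rewrite scale0r.
- exists (fun l => c l + e l); split=> [l||]; first exact: addr_ge0.
    by exists i; rewrite ltr_wpDr.
  by rewrite -big_split; apply: eq_bigr => l _; rewrite scalerDl.
- exists (fun l => r * c l); split=> [l||].
  + by rewrite mulr_ge0 // ltW.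
  + by exists i; rewrite mulr_gt0.
  + by rewrite scaler_sumr; apply: eq_bigr => l _; rewrite scalerA.
Qed.

(** Supplies the value of an eliminated coordinate, between its lower bounds [s] and its upper
    bounds [t]; either list may be empty. *)
Lemma strict_between (s t : seq F) :
  (forall x y, x \in s -> y \in t -> x < y) ->
  exists z, (forall x, x \in s -> x < z) /\ (forall y, y \in t -> z < y).
Proof.
elim: s t => [|x s IH] t st.
  elim: t {st} => [|y t [z [_ zt]]]; first by exists 0.
  exists (Num.min z (y - 1)); split=> // w; rewrite inE => /orP[/eqP->|/zt wz].
    by rewrite gt_min; apply/orP; right; lra.
  by rewrite gt_min wz.
have [|z [sz zt]] := IH t.
  by move=> a b a_s bt; apply: st => //; rewrite inE a_s orbT.
have [xz|zx] := ltP x z.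
  by exists z; split=> // w; rewrite inE => /orP[/eqP->|/sz].
have : exists y, x < y /\ forall w, w \in t -> y < w.
  have {st} xt w : w \in t -> x < w by move=> wt; apply: st; rewrite ?mem_head.
  elim: t xt {IH sz zt} => [|y t IH] xt; first by exists (x + 1); split=> //; lra.
  have [|y' [xy' y't]] := IH.
    by move=> w wt; apply: xt; rewrite inE wt orbT.
  have xy : x < y by apply: xt; rewrite mem_head.
  exists (Num.min y' ((x + y) / 2)); split.
    by rewrite lt_min xy' /=; lra.
  move=> w; rewrite inE => /orP[/eqP->|/y't wz]; rewrite gt_min ?wz //.
  by apply/orP; right; lra.
case=> y [xy yt]; exists y; split=> // w.
rewrite inE => /orP[/eqP->//|/sz ws].
by apply: lt_trans xy; apply: lt_le_trans zx.
Qed.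

Variable J : finType.
Definition dot (a : {ffun J -> F^o}) (y : J -> F) : F := \sum_j a j * y j.

(* Fourier-Motzkin elimination of the coordinates listed in [s]. *)
Lemma gordan (s : seq J) (A : seq {ffun J -> F^o}) :
  (forall a j, a \in A -> j \notin s -> a j = 0) ->
  (exists y, forall a, a \in A -> 0 < dot a y) \/
  pos_comb (fun a => a \in A) 0.
Proof.
elim: s A => [|j s IH] A As.
  case: A As => [|a A] As; first by left; exists (fun=> 0).
  right; have -> : 0 = a.
    by apply/ffunP => j; rewrite ffunE (As a j) // mem_head.
  by apply: pos_comb_gen; rewrite mem_head.
pose A0 := [seq a : {ffun J -> F^o} <- A | a j == 0].
pose Ap := [seq a : {ffun J -> F^o} <- A | 0 < a j].
pose An := [seq a : {ffun J -> F^o} <- A | a j < 0].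
(* For [a j > 0 > b j] this is a positive combination in which coordinate [j] cancels. *)
pose mix (a b : {ffun J -> F^o}) := (- b j) *: a + a j *: b.
have [|[y yP]|A'0] := IH (A0 ++ [seq mix a b | a <- Ap, b <- An]).
- move=> a l; rewrite mem_cat => /orP[|/allpairsP[[b c] /= [bP cN ->]]].
    rewrite mem_filter => /andP[/eqP aj aA] ls.
    by have [->//|lj] := eqVneq l j; apply: As => //; rewrite inE negb_or lj.
  move: bP cN; rewrite !mem_filter => /andP[_ bA] /andP[_ cA] ls.
  rewrite !ffunE; have [->|lj] := eqVneq l j; first by rewrite /GRing.scale /=; ring.
  have ljs : l \notin j :: s by rewrite inE negb_or lj.
  by rewrite (As _ _ bA ljs) (As _ _ cA ljs) !scaler0 addr0.
- left; have [|t [tp tn]] := @strict_between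
    [seq - dot a y / (a j : F) | a : {ffun J -> F^o} <- Ap]
    [seq dot b y / (- b j : F) | b : {ffun J -> F^o} <- An].
    move=> _ _ /mapP[a aP ->] /mapP[b bN ->].
    have := yP (mix a b); rewrite mem_cat allpairs_f ?orbT // => /(_ isT).
    have -> : dot (mix a b) y = - b j * dot a y + a j * dot b y.
      rewrite /dot !mulr_sumr -big_split; apply: eq_bigr => l _ /=.
      by rewrite !ffunE /GRing.scale /=; ring.
    move: aP bN; rewrite !mem_filter => /andP[aj _] /andP[bj _] h.
    rewrite ltr_pdivrMr // mulrAC ltr_pdivlMr ?oppr_gt0 //.
    by rewrite -subr_gt0; move: h; congr (_ < _); ring.
  exists (fun l => y l + t * (l == j)%:R) => a aA.
  have -> : dot a (fun l => y l + t * (l == j)%:R) = dot a y + t * a j.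
    rewrite /dot; under eq_bigr do rewrite mulrDr; rewrite big_split /=; congr +%R.
    rewrite (bigD1 j) //= eqxx big1 => [|l /negPf->]; last by rewrite !mulr0.
    by rewrite addr0 mulr1 mulrC.
  have [aj|aj|aj] := ltgtP (a j) 0.
  + have := tn _ (map_f (fun b : {ffun J -> F^o} => dot b y / (- b j)) _).
    move=> /(_ a); rewrite mem_filter aj aA => /(_ isT).
    by rewrite ltr_pdivlMr ?oppr_gt0 //; lra.
  + have := tp _ (map_f (fun b : {ffun J -> F^o} => - dot b y / b j) _).
    move=> /(_ a); rewrite mem_filter aj aA => /(_ isT).
    by rewrite ltr_pdivrMr //; lra.
  + by rewrite aj mulr0 addr0 yP // mem_cat mem_filter aj eqxx aA.
- right; apply: pos_comb_sub A'0 => a; rewrite mem_cat => /orP[|].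
    by rewrite mem_filter => /andP[_ aA]; apply: pos_comb_gen.
  move=> /allpairsP[[b c] /= [bP cN ->]].
  move: bP cN; rewrite !mem_filter => /andP[bj bA] /andP[cj cA].
  by apply: pos_comb_add; apply: pos_comb_scale; rewrite ?oppr_gt0 //; apply: pos_comb_gen.
Qed.

(** Gordan's alternative for the rows [- B i] together with the unit vectors. A solution is positive
    and can be normalised; in a dependence the unit vectors act as slack. *)
Lemma ville (I : finType) (B : I -> J -> F) : J ->
  (exists c : I -> F, [/\ forall i, 0 <= c i, \sum_i c i = 1
     & forall j, 0 <= \sum_i c i * B i j]) \/
  (exists y : J -> F, [/\ forall j, 0 <= y j, \sum_j y j = 1
     & forall i, \sum_j B i j * y j < 0]).
Proof.
move=> j0.
pose g (x : I + J) : {ffun J -> F^o} :=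
  match x with inl i => [ffun j => - B i j] | inr j => [ffun l => (l == j)%:R] end.
have [//|[y yP]|g0] := @gordan (enum J) [seq g x | x <- enum {: I + J}].
- by move=> a j _; rewrite mem_enum.
- right; have gy x : 0 < dot (g x) y by apply/yP/map_f; rewrite mem_enum.
  have y0 j : 0 < y j.
    have := gy (inr j); rewrite /dot (bigD1 j) //= ffunE eqxx mul1r big1 ?addr0 // => l.
    by rewrite ffunE => /negPf->; rewrite mul0r.
  have Y0 : 0 < \sum_j y j.
    rewrite (bigD1 j0) //= ltr_pwDl // sumr_ge0 // => j _; exact: ltW.
  exists (fun j => y j / \sum_j y j); split=> [j||i].
  + by rewrite divr_ge0 ?ltW.
  + by rewrite -mulr_suml divff // gt_eqF.
  + under eq_bigr do rewrite mulrA.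
    rewrite -mulr_suml pmulr_llt0 ?invr_gt0 // -oppr_gt0 -sumrN.
    have := gy (inl i); rewrite /dot; congr (_ < _); apply: eq_bigr => j _.
    by rewrite ffunE mulNr.
- left; have [|c [c0 [x0 cx0] cE]] := @pos_comb_coeffs {ffun J -> F^o} _ g 0.
    apply: pos_comb_sub g0 => a /mapP[x _ ->]; apply: pos_comb_gen; by exists x.
  have cJ j : \sum_i c (inl i) * B i j = c (inr j).
    move/ffunP: cE => /(_ j); rewrite ffunE sum_ffunE big_sumType /=.
    rewrite [X in _ + X](bigD1 j) //= !ffunE eqxx.
    rewrite [X in _ + (_ + X)]big1 => [|l jl]; last first.
      by rewrite !ffunE eq_sym (negPf jl) /GRing.scale /= mulr0.
    rewrite addr0 /GRing.scale /= mulr1 => h.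
    apply/eqP; rewrite -subr_eq0 -oppr_eq0 opprB addrC [X in _ == X]h.
    by rewrite -sumrN; apply/eqP; congr (_ + _); apply: eq_bigr => i _;
      rewrite !ffunE /GRing.scale /= mulrN.
  (* Unit vectors alone admit no nontrivial positive dependence, so some row has a positive
     coefficient. *)
  have C0 : 0 < \sum_i c (inl i).
    rewrite lt_def sumr_ge0 // andbT; apply/negP => /eqP C0.
    have cI i : c (inl i) = 0 by apply: (psumr_eq0P _ C0).
    case: x0 cx0 => [i|j]; first by rewrite cI ltxx.
    by rewrite -cJ big1 ?ltxx // => i _; rewrite cI mul0r.
  exists (fun i => c (inl i) / \sum_i c (inl i)); split=> [i||j].
  + by rewrite divr_ge0 ?c0 ?ltW.
  + by rewrite -mulr_suml divff // gt_eqF.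
  + under eq_bigr do rewrite mulrAC.
    by rewrite -mulr_suml cJ divr_ge0 ?c0 ?ltW.
Qed.

End LinearInequalities.

(** Conical version. While the support has more than [d] indices, its vectors are linearly
    dependent, and moving along a dependence until a coefficient vanishes shrinks the support. *)
Lemma caratheodory (F : realFieldType) (I : finType) (d : nat)
    (v : I -> 'rV[F]_d) (c : I -> F) :
  (forall i, 0 <= c i) ->
  exists c' : I -> F, [/\ forall i, 0 <= c' i,
    \sum_i c' i *: v i = \sum_i c i *: v i & (#|[set i | c' i != 0%R]| <= d)%N].
Proof.
have [N] := ubnP #|[set i | c i != 0]|; elim: N c => // N IH c.
set S := [set i | c i != 0]; rewrite ltnS => SN c0.
have [|dS] := leqP #|S| d; first by exists c.
pose M := \matrix_(r < #|S|) v (enum_val r).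
have : kermx M != 0.
  rewrite -mxrank_eq0 mxrank_ker subn_eq0 -ltnNge.
  exact: leq_ltn_trans (rank_leq_col _) dS.
case/rowV0Pn => u /sub_kermxP uM u0.
wlog [r0 ur0] : u uM u0 / exists r, 0 < u 0 r => [wl|].
  have /rV0Pn [r ur] := u0.
  have [|//|urn] := ltgtP (u 0 r) 0; last by rewrite urn eqxx in ur.
    move=> un; apply: (wl (- u)); rewrite ?mulNmx ?uM ?oppr0 ?oppr_eq0 //.
    by exists r; rewrite mxE oppr_gt0.
  by move=> up; apply: (wl u) => //; exists r.
have SI r : enum_val r \in S := enum_valP r.
(* The smallest ratio is the longest step along [- u] that keeps all coefficients nonnegative; it
   annihilates the one at [r]. *)
case: (@arg_minP _ _ _ r0 (fun r => 0 < u 0 r) (fun r => c (enum_val r) / u 0 r) ur0) => r ur rmin.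
set th := c (enum_val r) / u 0 r in rmin *.
pose e i := \sum_(x < #|S| | enum_val x == i) u 0 x.
have eE x : e (enum_val x) = u 0 x.
  by rewrite /e (big_pred1 x) // => y; rewrite (inj_eq enum_val_inj).
have eN i : i \notin S -> e i = 0.
  move=> iS; apply: big_pred0 => x; apply: contraNF iS => /eqP <-; exact: SI.
have thr : 0 <= th by rewrite divr_ge0 ?c0 // ltW.
have inS i : i \in S -> exists x : 'I_#|S|, i = enum_val x.
  by move=> iS; exists (enum_rank_in iS i); rewrite enum_rankK_in.
have c'0 i : 0 <= c i - th * e i.
  have [/inS[x ->]|/eN ->] := boolP (i \in S); last by rewrite mulr0 subr0.
  rewrite eE subr_ge0; have [ux|ux] := ltP 0 (u 0 x).
    by rewrite -ler_pdivlMr // rmin.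
  by apply: le_trans (c0 _); rewrite mulr_ge0_le0.
have [|c' [c'P1 c'P2 c'P3]] := IH (fun i => c i - th * e i) _ c'0; last first.
  exists c'; split=> //; rewrite c'P2.
  under eq_bigr do rewrite scalerBl; rewrite big_split /= sumrN.
  rewrite [X in _ - X](_ : _ = 0) ?subr0 //.
  under eq_bigr do rewrite -scalerA; rewrite -scaler_sumr.
  suff -> : \sum_i e i *: v i = u *m M by rewrite uM scaler0.
  rewrite mulmx_sum_row /e.
  under eq_bigr do rewrite scaler_suml.
  rewrite (exchange_big_dep predT) //=; apply: eq_bigr => x _.
  by rewrite (big_pred1 (enum_val x)) ?rowK // => i; rewrite eq_sym.
apply: leq_trans SN; apply: proper_card; apply/properP; split.
  apply/subsetP => i; rewrite !inE; apply: contraNN => /eqP ci.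
  by rewrite ci eN ?inE ?ci ?eqxx // mulr0 subr0.
exists (enum_val r); first exact: SI.
by rewrite inE eE divfK ?subrr ?eqxx // gt_eqF.
Qed.

(* Rounding [P * c] down costs less than 1 per index in the support, which
   the integrality gap 1 absorbs as soon as [P] exceeds the total loss. *)
Lemma integer_weights (I J E : finType) (v : I -> E -> int) (A : J -> E -> int)
    (B : I -> J -> int) (b P : nat) : J ->
  (forall i j, B i j = \sum_e A j e * v i e) ->
  (forall i j, `|B i j| <= b%:Z) ->
  (#|E|.+1 * b.+1 < P)%N ->
  (forall y : J -> rat, (forall j, 0 <= y j) -> \sum_j y j = 1 ->
     exists i, 0 <= \sum_j (B i j)%:~R * y j) ->
  exists w : I -> nat, [/\ forall i, (w i <= P)%N,
    (#|[set i | w i != 0%N]| <= #|E|.+1)%N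
    & forall j, - (\sum_i w i)%N%:Z < \sum_i (w i)%:Z * B i j].
Proof.
move=> j0 BE Bb bP game.
have [[c [c0 c1 cB]]|[y [y0 y1 yB]]] := ville (fun i j => (B i j)%:~R : rat) j0;
  last by have [i] := game y y0 y1; rewrite leNgt yB.
(* The extra entry 1 makes the reduction of the support preserve the total weight; it accounts for
   the successor in [#|E|.+1]. *)
pose u i : 'rV[rat]_(#|E|.+1) :=
  \row_r (if unlift ord0 r is Some e then (v i (enum_val e))%:~R else 1).
have [l [l0 lu lS]] := caratheodory u c0.
have l1 : \sum_i l i = 1.
  rewrite -[RHS]c1; move/rowP: lu => /(_ ord0); rewrite !summxE.
  have uE (a : I -> rat) : \sum_i (a i *: u i) 0 ord0 = \sum_i a i.
    by apply: eq_bigr => i _; rewrite !mxE unlift_none mulr1.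
  by rewrite !uE.
have lv e : \sum_i l i * (v i e)%:~R = \sum_i c i * (v i e)%:~R.
  move/rowP: lu => /(_ (lift ord0 (enum_rank e))); rewrite !summxE.
  have uE (a : I -> rat) :
      \sum_i (a i *: u i) 0 (lift ord0 (enum_rank e)) = \sum_i a i * (v i e)%:~R.
    by apply: eq_bigr => i _; rewrite !mxE liftK enum_rankK.
  by rewrite !uE.
have lB j : 0 <= \sum_i l i * (B i j)%:~R.
  have swap (a : I -> rat) : \sum_i a i * (B i j)%:~R =
      \sum_e (A j e)%:~R * \sum_i a i * (v i e)%:~R.
    under [RHS]eq_bigr do rewrite mulr_sumr; rewrite exchange_big /=.
    apply: eq_bigr => i _; rewrite BE rmorph_sum mulr_sumr /=.
    by apply: eq_bigr => e _; rewrite rmorphM /=; ring.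
  rewrite swap; under eq_bigr do rewrite lv.
  by rewrite -swap.
have le1 i : l i <= 1 by rewrite -l1 (bigD1 i) //= lerDl sumr_ge0.
pose w i := Num.truncn (l i * P%:R).
have wP i : (w i)%:R <= l i * P%:R < (w i)%:R + 1.
  by rewrite natr1 truncn_itv // mulr_ge0.
have w0 i : l i = 0 -> w i = 0%N.
  by move=> li; rewrite /w li mul0r truncn0.
exists w; split=> [i||j].
- rewrite -(ler_nat rat); have /andP[h _] := wP i; apply: le_trans h _.
  by rewrite ler_piMl.
- apply: leq_trans lS; apply/subset_leq_card/subsetP => i; rewrite !inE.
  by apply: contraNN => /eqP /w0 ->.
rewrite -(ltr_int rat) rmorphN /= -subr_gt0 opprK.
pose S := [set i | l i != 0].
(* Rounding changes [P * l i] by less than 1 and [B i j + 1] is at most [b + 1], so each index of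
   the support loses at most [b + 1]. *)
have step i : (P%:R * (l i * ((B i j)%:~R + 1)) - (i \in S)%:R * b.+1%:R <=
    ((w i)%:Z * B i j)%:~R + (w i)%:R :> rat).
  rewrite rmorphM /= inE; have [li|li] /= := eqVneq (l i) 0.
    by rewrite li (w0 _ li) !(mul0r, mulr0) !add0r.
  have /andP[h1 h2] := wP i; have : `|(B i j)%:~R| <= b%:R :> rat.
    by rewrite -intr_norm -[b%:R]/(b%:Z%:~R) ler_int.
  rewrite ler_norml => /andP[h3 h4]; rewrite -natr1 -[(w i)%:~R]/((w i)%:R).
  rewrite mul1r; nra.
have : \sum_i (P%:R * (l i * ((B i j)%:~R + 1)) - (i \in S)%:R * b.+1%:R) <=
  \sum_i (((w i)%:Z * B i j)%:~R + (w i)%:R) :> rat by apply: ler_sum.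
rewrite big_split /= -mulr_sumr sumrN -mulr_suml.
have -> : \sum_i l i * ((B i j)%:~R + 1) = \sum_i l i * (B i j)%:~R + 1.
  by rewrite -[X in _ = _ + X]l1 -big_split; apply: eq_bigr => i _; rewrite mulrDr mulr1.
have <- : (\sum_i (w i)%:Z * B i j)%:~R + (\sum_i (w i)%:R) =
    \sum_i (((w i)%:Z * B i j)%:~R + (w i)%:R) :> rat.
  by rewrite rmorph_sum big_split.
have <- : (\sum_i w i)%N%:Z%:~R = \sum_i (w i)%:R :> rat by rewrite -natr_sum.
move=> h; apply: lt_le_trans h; rewrite subr_gt0.
have -> : \sum_i (i \in S)%:R = #|S|%:R :> rat.
  by rewrite -natr_sum -big_mkcond sum1_card.
apply: lt_le_trans (_ : P%:R <= _); last by rewrite ler_peMr // lerDr.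
rewrite -natrM ltr_nat; apply: leq_ltn_trans bP.
by rewrite leq_mul2r lS orbT.
Qed.

(** * Lower bounds from chains *)

Lemma big_diamond (R : nmodType) (k : nat) (g : diamond k -> R) :
  \sum_z g z = g DBot + g DTop + \sum_a g (DAtom a).
Proof.
rewrite (bigD1 DBot) //= (bigD1 DTop) //= addrA; congr +%R.
rewrite (reindex_omap (@DAtom k) (fun z => if z is DAtom a then Some a else None)).
  by apply: eq_bigl => a; rewrite eqxx.
by case.
Qed.

Section Chains.
Variables (k n : nat) (n_gt0 : (0 < n)%N).
Local Notation D := (diamond k).
Local Notation Ln := (n.-tupleprod D).
Variable f : Ln -> int.
Hypothesis fsub : submodular f.

Definition upt (t : Ln) (i : 'I_n) (y : D) : Ln :=
  [tuple if l == i then y else tnth t l | l < n].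

Definition coord (q : nat) : 'I_n := Ordinal (ltn_pmod q n_gt0).

Definition bot_tuple : Ln := [tuple DBot | _ < n].

Lemma tnth_upt t i y l : tnth (upt t i y) l = if l == i then y else tnth t l.
Proof. by rewrite tnth_mktuple. Qed.

Lemma upt_id t i : upt t i (tnth t i) = t.
Proof. by apply: eq_from_tnth => l; rewrite tnth_upt; case: eqP => // ->. Qed.

Lemma upt_meet t i y z : (upt t i y `&` upt t i z)%O = upt t i (y `&` z)%O.
Proof.
by apply: eq_from_tnth => l; rewrite tnth_meet !tnth_upt;
  case: eqP; rewrite ?meetxx.
Qed.

Lemma upt_join t i y z : (upt t i y `|` upt t i z)%O = upt t i (y `|` z)%O.
Proof.
by apply: eq_from_tnth => l; rewrite tnth_join !tnth_upt;
  case: eqP; rewrite ?joinxx.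
Qed.

(* A chain is given by its moves: move [q] raises coordinate [q %% n] from its
   current value [x] to [x `|` v q]. Any [v] is allowed; moves with [v q <= x]
   have no effect. *)
Definition slope (x y z : D) : D := (x `|` (z `&` (x `|` y)))%O.

Fixpoint cur (v : nat -> D) (q : nat) : Ln :=
  if q is q'.+1 then
    upt (cur v q') (coord q') (tnth (cur v q') (coord q') `|` v q')%O
  else bot_tuple.

Definition gain (v : nat -> D) (q : nat) (z : D) : int :=
  f (upt (cur v q) (coord q) (slope (tnth (cur v q) (coord q)) (v q) z))
  - f (cur v q).

(** Submodularity at [t] meet [cur v q.+1] and [cur v q]: the meet of the two is [t] meet [cur v q],
    and their join differs from [cur v q] only at the moved coordinate, where it is the slope. So
    the bound sees a single coordinate of [t]. *)
Lemma gain_le v q (t : Ln) :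
  gain v q (tnth t (coord q)) <= f (t `&` cur v q.+1)%O - f (t `&` cur v q)%O.
Proof.
have := fsub (t `&` cur v q.+1)%O (cur v q).
have -> : (t `&` cur v q.+1 `&` cur v q)%O = (t `&` cur v q)%O.
  rewrite -meetA; congr Order.meet; apply/meet_idPr; rewrite leEtprod.
  apply/forallP => l; rewrite /= tnth_upt; case: eqP => // ->; exact: leUl.
have -> : (t `&` cur v q.+1 `|` cur v q)%O =
    upt (cur v q) (coord q) (slope (tnth (cur v q) (coord q)) (v q) (tnth t (coord q))).
  apply: eq_from_tnth => l.
  rewrite tnth_join tnth_meet /= !tnth_upt.
  by case: eqP => [->|_]; [rewrite joinC | rewrite joinC meetC meetKU].
rewrite /gain; lra.
Qed.

Lemma chain_bound v q (t : Ln) :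
  f bot_tuple + \sum_(r < q) gain v r (tnth t (coord r)) <= f (t `&` cur v q)%O.
Proof.
elim: q => [|q IH].
  rewrite big_ord0 addr0 /=; suff -> : (t `&` bot_tuple)%O = bot_tuple by [].
  by apply: eq_from_tnth => l; rewrite tnth_meet !tnth_mktuple meetx0.
rewrite big_ord_recr /=; have := gain_le v q t; lra.
Qed.

(** Any [n] consecutive moves visit every coordinate, and a coordinate at the top stays there. *)
Lemma cur_top v c l : (forall q, (c <= q < c + n)%N -> v q = DTop) ->
  tnth (cur v (c + n)) l = DTop.
Proof.
move=> vtop.
have topS q : tnth (cur v q) l = DTop -> tnth (cur v q.+1) l = DTop.
  by move=> /= ql; rewrite tnth_upt; case: eqP => // <-; rewrite ql.
have [q [/andP[cq qc] ql]] : exists q, (c <= q < c + n)%N /\ coord q = l.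
  have lc : (c %/ n * n + l < c + n)%N.
    by rewrite {2}(divn_eq c n) -addnA ltn_add2l (leq_trans (ltn_ord l)) ?leq_addl.
  have [cl|cl] := leqP c (c %/ n * n + l).
    by exists (c %/ n * n + l)%N; split; [rewrite cl|apply: val_inj => /=; rewrite modnMDl modn_small].
  exists ((c %/ n).+1 * n + l)%N; split; last by apply: val_inj; rewrite /= modnMDl modn_small.
  rewrite mulSn -addnA [X in (_ < X)%N]addnC ltn_add2l cl andbT.
  apply: leq_trans (_ : (c %/ n).+1 * n <= _)%N; first by rewrite ltnW // ltn_ceil.
  by rewrite mulSn leq_add2l leq_addr.
have : tnth (cur v q.+1) l = DTop.
  by rewrite /= tnth_upt ql eqxx vtop ?cq // joinx1.
move: qc; rewrite -ltnS; elim: (c + n)%N => // N IH; rewrite ltnS leq_eqVlt.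
by case/orP => [/eqP <-//|/IH h /h /topS].
Qed.

Lemma chain_bound_top v c (t : Ln) : (forall q, (c <= q < c + n)%N -> v q = DTop) ->
  f bot_tuple + \sum_(r < c + n) gain v r (tnth t (coord r)) <= f t.
Proof.
move=> vtop; apply: le_trans (chain_bound v _ t) _.
suff -> : (t `&` cur v (c + n))%O = t by [].
apply: eq_from_tnth => l.
by rewrite tnth_meet cur_top // meetx1.
Qed.


(** * The threshold chain answering given marginals *)

Section Thresholds.
Variables (m : int) (m_le : forall t, m <= f t).
Variable mu : 'I_n -> D -> rat.
Hypothesis mu0 : forall i z, 0 <= mu i z.
Hypothesis mu1 : forall i, \sum_z mu i z = 1.

Definition atom_mass i : rat := \sum_a mu i (DAtom a).

(* The two levels at which the threshold chain leaves DBot and reaches DTop: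
   through the atom carrying more than half of the mass of the atoms if there
   is one, and directly otherwise. *)
Record levels (i : 'I_n) := Levels {
  lev_mid : D; lev_hi : rat; lev_lo : rat;
  lev_bounds : [/\ 0 <= lev_lo, lev_lo <= lev_hi & lev_hi <= 1];
  lev_split : lev_lo < lev_hi -> exists p, [/\ lev_mid = DAtom p,
    lev_hi = mu i (DAtom p) + mu i DTop
    & lev_lo = atom_mass i - mu i (DAtom p) + mu i DTop];
  lev_jump : lev_lo = lev_hi -> lev_hi = mu i DTop + atom_mass i / 2
    /\ forall a, mu i (DAtom a) <= atom_mass i / 2 }.

Lemma levels_exist i : levels i.
Proof.
have M0 : 0 <= atom_mass i by apply: sumr_ge0.
have M1 : mu i DBot + mu i DTop + atom_mass i = 1 by rewrite -(mu1 i) big_diamond.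
have pM p : mu i (DAtom p) <= atom_mass i.
  by rewrite /atom_mass (bigD1 p) //= lerDl sumr_ge0.
have := mu0 i DBot; have := mu0 i DTop => t0 b0.
case: (pickP (fun p => atom_mass i / 2 < mu i (DAtom p))) => [p pP|noP].
  have := pM p => pM'.
  exists (DAtom p) (mu i (DAtom p) + mu i DTop) (atom_mass i - mu i (DAtom p) + mu i DTop).
  - by split; lra.
  - by exists p.
  - lra.
exists DBot (mu i DTop + atom_mass i / 2) (mu i DTop + atom_mass i / 2).
- by split; lra.
- by rewrite ltxx.
- by split=> // a; rewrite leNgt noP.
Qed.

Definition shape (th : rat) (i : 'I_n) : D :=
  let l := levels_exist i in
  if th <= lev_lo l then DTop else if th <= lev_hi l then lev_mid l else DBot.

Definition level_seq : seq rat :=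
  sort >=%R ([seq lev_lo (levels_exist i) | i <- enum 'I_n] ++
             [seq lev_hi (levels_exist i) | i <- enum 'I_n]).

(** The sweep starts at 2, above every threshold, where all shapes are [DBot]; past the end of the
    list the default 0 gives [DTop] everywhere. *)
Definition level (c : nat) : rat :=
  if c is c'.+1 then nth 0 level_seq c' else 2.

(** The moves come in blocks of [n]; block [c] brings the coordinates one after the other to their
    shape at level [c.+1]. *)
Definition threshold_moves (q : nat) : D := shape (level (q %/ n).+1) (coord q).

Lemma size_level_seq : size level_seq = n.*2.
Proof. by rewrite size_sort size_cat !size_map -!enumT -cardT card_ord addnn. Qed.

Lemma level_mem c : (c < n.*2)%N -> exists i,
  level c.+1 = lev_lo (levels_exist i) \/ level c.+1 = lev_hi (levels_exist i).
Proof.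
rewrite -size_level_seq => /(mem_nth 0); rewrite mem_sort mem_cat.
by case/orP => /mapP[i _ /= ->]; exists i; [left|right].
Qed.

Lemma level_ge0 c : 0 <= level c.
Proof.
case: c => [|c]; first by [].
have [cn|cn] := ltnP c n.*2; last by rewrite /= nth_default // size_level_seq.
have [i [->|->]] := level_mem cn; case: (lev_bounds (levels_exist i)) => h1 h2 h3 //.
exact: le_trans h2.
Qed.

Lemma level_le1 c : level c.+1 <= 1.
Proof.
have [cn|cn] := ltnP c n.*2; last by rewrite /= nth_default // size_level_seq.
have [i [->|->]] := level_mem cn; case: (lev_bounds (levels_exist i)) => h1 h2 h3 //.
exact: le_trans h3.
Qed.

Lemma level_sorted c1 c2 : (c1 <= c2)%N -> level c2 <= level c1.
Proof.
move=> h; apply: (@homo_leq _ level (fun x y => y <= x)) h => [x//|y x z h1 h2|c].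
  exact: le_trans h2 h1.
case: c => [|c]; first by apply: le_trans (level_le1 0) _.
have [cn|cn] := ltnP c.+1 n.*2.
  have /(sortedP 0) : sorted >=%R level_seq := sort_sorted (@ge_total _ rat) _.
  by apply; rewrite size_level_seq.
by rewrite [level c.+2]/= nth_default ?size_level_seq // level_ge0.
Qed.

(** No listed threshold lies strictly between consecutive levels. Hence a coordinate changes its
    shape only when the new level is exactly one of its own thresholds. *)
Lemma level_hit c x : x \in level_seq -> x < level c -> level c.+1 <= x -> level c.+1 = x.
Proof.
move=> /(nthP 0)[r _ rx] xc cx; apply/eqP; rewrite eq_le cx andTb.
have -> : x = level r.+1 by [].
apply: level_sorted; rewrite ltnNge; apply/negP => rc.
have := level_sorted rc; rewrite [level r.+1]rx leNgt.
by rewrite xc.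
Qed.

Lemma lo_mem i : lev_lo (levels_exist i) \in level_seq.
Proof.
by rewrite mem_sort mem_cat (map_f (fun i => lev_lo (levels_exist i))) ?mem_enum.
Qed.

Lemma hi_mem i : lev_hi (levels_exist i) \in level_seq.
Proof.
by rewrite mem_sort mem_cat orbC (map_f (fun i => lev_hi (levels_exist i))) ?mem_enum.
Qed.

Lemma shape_mono th th' i : th' <= th -> (shape th i <= shape th' i)%O.
Proof.
move=> h; rewrite /shape; case: (lev_bounds (levels_exist i)) => _ lh _.
have [h1|h1] := leP th; first by rewrite (le_trans h h1).
have [h2|h2] := leP th; last exact: le0x.
case: ifP => _; first exact: lex1.
by rewrite (le_trans h h2).
Qed.

Lemma shape0 i : shape 0 i = DTop.
Proof. by rewrite /shape; case: (lev_bounds (levels_exist i)) => ->. Qed.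

Lemma threshold_moves_top q : (n.*2 * n <= q)%N -> threshold_moves q = DTop.
Proof.
move=> h; rewrite /threshold_moves /= nth_default ?shape0 //.
by rewrite size_level_seq leq_divRL.
Qed.

(** Shapes grow as the level falls, so joining the new shape to the current value just replaces
    it. *)
Lemma threshold_cur c r l : (r <= n)%N ->
  tnth (cur threshold_moves (c * n + r)) l =
  shape (if (l < r)%N then level c.+1 else level c) l.
Proof.
have step c' r' : (r' < n)%N ->
    (forall l, tnth (cur threshold_moves (c' * n + r')) l =
       shape (if (l < r')%N then level c'.+1 else level c') l) ->
    forall l, tnth (cur threshold_moves (c' * n + r'.+1)) l =
       shape (if (l < r'.+1)%N then level c'.+1 else level c') l.
  move=> rn IH {}l; rewrite addnS /= tnth_upt.
  have cr : val (coord (c' * n + r')) = r' by rewrite /= modnMDl modn_small.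
  have [->|lr] := eqVneq l (coord (c' * n + r')).
    rewrite IH cr ltnn ltnSn /threshold_moves divnMDl // divn_small // addn0.
    by apply/join_idPr/shape_mono/level_sorted.
  rewrite IH [(l < r'.+1)%N]ltnS [(l <= r')%N]leq_eqVlt; suff -> : (l == r' :> nat) = false by [].
  by apply: contraNF lr => /eqP lr; apply/eqP/val_inj; rewrite cr.
elim: c r l => [|c IHc] r; elim: r => [|r IHr] l rn.
- rewrite mul0n /= tnth_mktuple /shape.
  case: (lev_bounds (levels_exist l)) => h1 h2 h3.
  have h4 : lev_hi (levels_exist l) < 2 by apply: le_lt_trans h3 _.
  by rewrite (lt_geF (le_lt_trans h2 h4)) (lt_geF h4).
- by apply: step => // l'; apply: IHr; apply: ltnW.
- by rewrite addn0 mulSn addnC IHc // ltn_ord.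
- by apply: step => // l'; apply: IHr; apply: ltnW.
Qed.

(** Put [G z = F z - F DBot]. Distinct atoms satisfy [G DTop <= G a + G b], so at most one atom [p]
    has [G p] below [G DTop / 2], and every other atom then has at least [G DTop - G p]. Since [p]
    carries at most half of the atom mass, the others make up for its deficit. *)
Lemma half_mass_jump i (F : D -> int) :
  (forall a b, a != b -> F DBot + F DTop <= F (DAtom a) + F (DAtom b)) ->
  (forall a, mu i (DAtom a) <= atom_mass i / 2) ->
  (mu i DTop + atom_mass i / 2) * (F DTop - F DBot)%:~R <=
  \sum_z mu i z * (F z - F DBot)%:~R.
Proof.
move=> Fsub half; rewrite big_diamond subrr mulr0 add0r mulrDl lerD2l.
pose G z : rat := (F z - F DBot)%:~R; rewrite -[X in _ * X]/(G DTop).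
have Gsub a b : a != b -> G DTop <= G (DAtom a) + G (DAtom b).
  by move/Fsub; rewrite /G -rmorphD ler_int; lra.
case: (pickP (fun p => G (DAtom p) < G DTop / 2)) => [p pP|noP]; last first.
  rewrite mulrAC -mulrA /atom_mass mulr_suml; apply: ler_sum => a _.
  rewrite ler_wpM2l //; move: (noP a) => /negbT; rewrite -leNgt => /le_trans; apply.
  by rewrite /G; lra.
have -> : \sum_a mu i (DAtom a) * (F (DAtom a) - F DBot)%:~R =
    mu i (DAtom p) * G (DAtom p) + \sum_(a | a != p) mu i (DAtom a) * G (DAtom a).
  by rewrite (bigD1 p).
have rest : atom_mass i - mu i (DAtom p) = \sum_(a | a != p) mu i (DAtom a).
  by rewrite /atom_mass (bigD1 p) //=; lra.
have : (atom_mass i - mu i (DAtom p)) * (G DTop - G (DAtom p)) <=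
    \sum_(a | a != p) mu i (DAtom a) * G (DAtom a).
  rewrite rest mulr_suml; apply: ler_sum => a ap.
  by rewrite ler_wpM2l //; have := Gsub _ _ ap; lra.
set rest_sum := \sum_(a | _) _; have := half p; move: pP.
move: (atom_mass i) (mu i (DAtom p)) (G DTop) (G (DAtom p)) rest_sum => M u T g r.
move=> gT uM; have : 0 <= (M / 2 - u) * (T - 2 * g) by apply: mulr_ge0; lra.
lra.
Qed.

(** By [level_hit], the level of an effective move is a threshold of its coordinate. For the moves
    from [DBot] to [p] and from [p] to [DTop], this threshold is the mass of the values [z] on which
    the gain is the full increase of [f]; on all others the gain is 0. The direct jump is
    [half_mass_jump]. *)
Lemma threshold_step q :
  level (q %/ n).+1 *
    (f (cur threshold_moves q.+1) - f (cur threshold_moves q))%:~R <=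
  \sum_z mu (coord q) z * (gain threshold_moves q z)%:~R.
Proof.
set c := (q %/ n)%N; set i := coord q; rewrite /gain [cur _ q.+1]/= -/i.
have cl l := @threshold_cur c (q %% n) l (ltnW (ltn_pmod q n_gt0)).
have x_shape : tnth (cur threshold_moves q) i = shape (level c) i.
  by rewrite [in cur _ q](divn_eq q n) cl ltnn.
set t := cur threshold_moves q in x_shape *.
have y_shape : threshold_moves q = shape (level c.+1) i by [].
have t_id : f t = f (upt t i (tnth t i)) by rewrite upt_id.
rewrite y_shape t_id x_shape.
set x := shape (level c) i; set y := shape (level c.+1) i.
have xy : (x <= y)%O by apply/shape_mono/level_sorted.
have joinE : (x `|` y)%O = y by apply/join_idPr.
rewrite /slope joinE; set F := fun z => f (upt t i z).
have [xyE|xNy] := eqVneq x y.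
  rewrite -xyE subrr mulr0 big1 // => z _.
  suff -> : (x `|` (z `&` x))%O = x by rewrite subrr mulr0.
  by apply/join_idPl; exact: leIr.
have F_sub a b : a != b -> F DBot + F DTop <= F (DAtom a) + F (DAtom b).
  move=> ab; have := fsub (upt t i (DAtom a)) (upt t i (DAtom b)).
  by rewrite upt_meet upt_join /Order.meet /Order.join /= (negPf ab).
have [h1 h2 h3] := lev_bounds (levels_exist i).
have lohit := level_hit (lo_mem i) (c := c).
have hihit := level_hit (hi_mem i) (c := c).
move: xNy xy {joinE x_shape y_shape t_id}; rewrite {}/x {}/y /shape.
case: (leP (level c)) => [cl0|cl0].
  by rewrite (le_trans (level_sorted (leqnSn c)) cl0) eqxx.
case: (leP (level c)) => [cl1|cl1].
  have [p [-> hiE loE]] := lev_split (lt_le_trans cl0 cl1).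
  case: (leP (level c.+1)) => [cl2 _ _|cl2].
    rewrite lohit // loE big_diamond.
    have -> : (DAtom p `|` (DBot `&` DTop))%O = DAtom p by [].
    have -> : (DAtom p `|` (DTop `&` DTop))%O = DTop by [].
    have E a : (DAtom p `|` (DAtom a `&` DTop))%O = if p == a then DAtom p else DTop by [].
    rewrite (bigD1 p) //= E eqxx !subrr !mulr0 !add0r mulrDl [X in X <= _]addrC lerD2l.
    rewrite /atom_mass (bigD1 p) //= addrAC subrr add0r mulr_suml.
    by apply: ler_sum => a ap; rewrite E eq_sym (negPf ap).
  case: (leP (level c.+1)) => [_|]; first by rewrite eqxx.
  by move=> /lt_le_trans /(_ (level_sorted (leqnSn c))); rewrite ltNge cl1.
case: (leP (level c.+1)) => [cl2 _ _|cl2].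
  (* Both thresholds are passed in one step, so both equal the new level and the case [lev_jump]
     applies. *)
  have hE := hihit cl1 (le_trans cl2 h2).
  have hlE : lev_lo (levels_exist i) = lev_hi (levels_exist i).
    by apply/eqP; rewrite eq_le h2 -hE.
  have [hiE half] := lev_jump hlE.
  rewrite hE hiE; apply: le_trans (half_mass_jump F_sub half) _.
  by apply: ler_sum => z _; rewrite /F join0x meetx1.
case: (leP (level c.+1)) => [cl3 _ _|]; last by rewrite eqxx.
have [p [-> hiE loE]] := lev_split (lt_le_trans cl2 cl3).
rewrite hihit // hiE big_diamond.
have -> : (DBot `|` (DBot `&` DAtom p))%O = DBot by [].
have -> : (DBot `|` (DTop `&` DAtom p))%O = DAtom p by [].
have E a : (DBot `|` (DAtom a `&` DAtom p))%O = if a == p then DAtom a else DBot.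
  by rewrite /Order.meet /=; case: ifP.
rewrite (bigD1 p) //= E eqxx subrr mulr0 add0r mulrDl [X in X <= _]addrC lerD2l lerDl big1 // => a ap.
by rewrite E (negPf ap) subrr mulr0.
Qed.

(** Summation by parts turns the right-hand side into an average of values of [g], with weights
    [1 - a 0], the successive decrements of [a], and the last [a]. The induction keeps the remaining
    mass [a N] on [g N]. *)
Lemma abel_bound (a : nat -> rat) (g : nat -> int) N :
  (forall q, a q.+1 <= a q) -> a 0%N <= 1 -> (forall q, 0 <= a q) ->
  (forall q, m <= g q) ->
  m%:~R <= (g 0%N)%:~R + \sum_(q < N) a q * (g q.+1 - g q)%:~R.
Proof.
move=> a_dec a_le1 a_ge0 mg.
have mgR q : m%:~R <= (g q)%:~R :> rat by rewrite ler_int.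
suff : m%:~R + a N * ((g N)%:~R - m%:~R) <=
    (g 0%N)%:~R + \sum_(q < N) a q * (g q.+1 - g q)%:~R.
  apply: le_trans; rewrite lerDl mulr_ge0 // subr_ge0; exact: mgR.
elim: N => [|N IH].
  rewrite big_ord0 addr0 -lerBrDl ler_piMl // subr_ge0; exact: mgR.
rewrite big_ord_recr /= addrA; apply: le_trans (lerD IH (lexx _)).
rewrite -addrA lerD2l rmorphB /= -mulrDr.
have -> : (g N)%:~R - m%:~R + ((g N.+1)%:~R - (g N)%:~R) = (g N.+1)%:~R - m%:~R :> rat.
  by ring.
by rewrite ler_wpM2r // subr_ge0; exact: mgR.
Qed.

Lemma threshold_chain_bound N :
  m%:~R <= (f bot_tuple)%:~R +
    \sum_(q < N) \sum_z mu (coord q) z * (gain threshold_moves q z)%:~R.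
Proof.
apply: le_trans (@abel_bound (fun q => level (q %/ n).+1)
  (fun q => f (cur threshold_moves q)) N _ _ _ _) _ => //.
- by move=> q; apply: level_sorted; rewrite ltnS leq_div2r.
- exact: level_le1.
- by move=> q; apply: level_ge0.
by rewrite lerD2l; apply: ler_sum => q _; exact: threshold_step.
Qed.

End Thresholds.

End Chains.

(** * Short integral certificates *)

Definition moves (n : nat) : nat := (n.*2 * n)%N.
(** A chain has [2 n] levels of [n] moves, after which [n] more moves lead to the top. The slots are
    the bound of Caratheodory's theorem: one dimension for each pair of a coordinate and a value,
    and one for the total weight. *)
Definition slots (k n : nat) : nat := (n * #|{: diamond k}|).+1.

Section Certificate.
Variables (k n : nat) (n_gt0 : (0 < n)%N).
Local Notation D := (diamond k).
Local Notation Ln := (n.-tupleprod D).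
Variable f : Ln -> int.
Hypothesis fsub : submodular f.

Lemma eq_cur (v v' : nat -> D) q : v =1 v' -> cur n_gt0 v q = cur n_gt0 v' q.
Proof. by move=> vv; elim: q => //= q ->; rewrite vv. Qed.

Lemma eq_gain (v v' : nat -> D) q z :
  v =1 v' -> gain n_gt0 f v q z = gain n_gt0 f v' q z.
Proof. by move=> vv; rewrite /gain (eq_cur q vv) vv. Qed.

Definition chain_value (v : nat -> D) (t : Ln) : int :=
  f (bot_tuple k n) +
  \sum_(q < moves n + n) gain n_gt0 f v q (tnth t (coord n_gt0 q)).

Lemma chain_value_le (v : nat -> D) t :
  (forall q, (moves n <= q)%N -> v q = DTop) -> chain_value v t <= f t.
Proof.
by move=> vtop; apply: chain_bound_top => // q /andP[h _]; exact: vtop.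
Qed.

Lemma chain_value_bound (v : nat -> D) t F : (forall t, `|f t| <= F%:Z) ->
  `|chain_value v t| <= (F * (2 * (moves n + n)).+1)%N%:Z.
Proof.
move=> Fb; apply: le_trans (ler_normD _ _) _.
rewrite mulnS PoszD lerD //; apply: le_trans (ler_norm_sum _ _ _) _.
rewrite [X in _ <= X](_ : _ = \sum_(q < moves n + n) (2 * F)%N%:Z).
  by apply: ler_sum => q _; apply: le_trans (ler_normB _ _) _; rewrite mul2n -addnn PoszD lerD.
by rewrite sumr_const card_ord -mulr_natr natz -PoszM; congr Posz; lia.
Qed.

(** A chain value is separable, so its expectation under [y] depends on the marginals only, and the
    threshold chain of these marginals answers [y]. *)
Lemma game_value (m : int) (y : Ln -> rat) : (forall t, m <= f t) ->
  (forall t, 0 <= y t) -> \sum_t y t = 1 ->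
  exists2 v : nat -> D, forall q, (moves n <= q)%N -> v q = DTop &
    0 <= \sum_t (chain_value v t - m)%:~R * y t.
Proof.
move=> mf y0 y1.
pose mu (i : 'I_n) (z : D) : rat := \sum_(t : Ln | tnth t i == z) y t.
have mu0 i z : 0 <= mu i z by apply: sumr_ge0.
have mu_sum i (g : D -> rat) : \sum_z mu i z * g z = \sum_t y t * g (tnth t i).
  rewrite (partition_big (fun t : Ln => tnth t i) predT) //=.
  by apply: eq_bigr => z _; rewrite mulr_suml; apply: eq_bigr => t /eqP ->.
have mu1 i : \sum_z mu i z = 1.
  by rewrite -y1 -[RHS](eq_bigr _ (fun t _ => mulr1 (y t))) -(mu_sum i (fun=> 1));
    apply: eq_bigr => z _; rewrite mulr1.
exists (threshold_moves n_gt0 mu0 mu1) => [q|]; first exact: threshold_moves_top.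
have := threshold_chain_bound n_gt0 fsub mf mu0 mu1 (moves n + n).
rewrite -subr_ge0 => /le_trans; apply.
under eq_bigr do rewrite (mu_sum _ (fun z => _%:~R)).
rewrite exchange_big /= -[X in X + _ - _]mul1r -[X in _ - X]mul1r -y1 !mulr_suml.
rewrite -big_split -sumrB /=; apply: ler_sum => t _.
rewrite -mulr_sumr -mulrDr -mulrBr mulrC ler_wpM2r //.
by rewrite y1 /chain_value rmorphB rmorphD rmorph_sum.
Qed.

(** The difference [chain_value - m] is a linear form in the indicators of the pairs (coordinate,
    value), so [integer_weights] applies; [game_value] is its hypothesis on distributions. *)
Lemma certificate_exists (m : int) (F P : nat) :
  (forall t, m <= f t) -> `|m| <= F%:Z -> (forall t, `|f t| <= F%:Z) ->
  (slots k n * (F * (2 * (moves n + n)).+2).+1 < P)%N ->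
  exists (V : nat -> nat -> D) (W : nat -> nat),
    [/\ forall j, (W j <= P)%N,
      forall j q, (moves n <= q)%N -> V j q = DTop
      & forall t, (\sum_(j < slots k n) W j)%N%:Z * (m - 1) <
          \sum_(j < slots k n) (W j)%:Z * chain_value (V j) t].
Proof.
move=> mf mF Ff FP.
pose mv (c : {ffun 'I_(moves n) -> D}) q : D := if insub q is Some r then c r else DTop.
have mv_top c q : (moves n <= q)%N -> mv c q = DTop.
  by move=> h; rewrite /mv insubF // ltnNge h.
(* The constant term is charged to coordinate 0, which makes the form homogeneous in the
   indicators. *)
pose v c (e : 'I_n * D) := (e.1 == coord n_gt0 0)%:R * (f (bot_tuple k n) - m) +
  \sum_(q < moves n + n | coord n_gt0 q == e.1) gain n_gt0 f (mv c) q e.2.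
pose A (t : Ln) (e : 'I_n * D) : int := (tnth t e.1 == e.2)%:R.
have [||||w [wP wS wB]] := @integer_weights _ _ _ v A
    (fun c t => chain_value (mv c) t - m) (F * (2 * (moves n + n)).+2) P (bot_tuple k n).
- move=> c t; rewrite -(pair_bigA _ (fun i z => A t (i, z) * v c (i, z))) /=.
  transitivity (\sum_i v c (i, tnth t i)); last first.
    apply: eq_bigr => i _; rewrite (bigD1 (tnth t i)) //= big1 ?addr0 => [|z zt].
      by rewrite /A eqxx mul1r.
    by rewrite /A eq_sym (negPf zt) mul0r.
  rewrite /v /= big_split /= -mulr_suml (bigD1 (coord n_gt0 0)) //= eqxx.
  rewrite big1 => [|i /negPf -> //]; rewrite addr0 mul1r /chain_value addrAC.
  congr +%R; rewrite (partition_big (fun q : 'I_(moves n + n) => coord n_gt0 q) predT) //=.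
  by apply: eq_bigr => i _; apply: eq_bigr => q /eqP ->.
- move=> c t; apply: le_trans (ler_normB _ _) _.
  by rewrite mulnS addnC PoszD lerD // chain_value_bound.
- by apply: leq_ltn_trans FP; rewrite card_prod card_ord.
- move=> y y0 y1; have [u u_top uB] := game_value mf y0 y1.
  exists [ffun r : 'I_(moves n) => u r]; apply: le_trans uB _.
  rewrite le_eqVlt; apply/orP; left; apply/eqP.
  apply: eq_bigr => t _; congr (_%:~R * _); congr (_ - _); congr (_ + _).
  apply: eq_bigr => q _; apply: eq_gain => r.
  rewrite /mv; case: insubP => [x _ <-|]; first by rewrite ffunE.
  by rewrite -leqNgt => /u_top.
set S := [set c | w c != 0%N] in wS.
pose c0 : {ffun 'I_(moves n) -> D} := [ffun=> DTop].
pose cj j := nth c0 (enum S) j.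
(* The support is listed in the first slots; the remaining slots get weight 0. *)
exists (fun j => mv (cj j)), (fun j => if (j < #|S|)%N then w (cj j) else 0%N); split.
- by move=> j; case: ifP.
- by move=> j q; apply: mv_top.
have S_slots : (#|S| <= slots k n)%N.
  by apply: leq_trans wS _; rewrite card_prod card_ord.
have sumS (R : nmodType) (g : {ffun 'I_(moves n) -> D} -> nat -> R) :
    (forall c, g c 0%N = 0) ->
    \sum_(j < slots k n) g (cj j) (if (j < #|S|)%N then w (cj j) else 0%N) =
    \sum_c g c (w c).
  move=> g0; transitivity (\sum_(j < #|S|) g (cj j) (w (cj j))).
    rewrite (big_ord_widen _ (fun j => g (cj j) (w (cj j))) S_slots) big_mkcond /=.
    by rewrite [RHS]big_mkcond; apply: eq_bigr => j _ /=; case: ifP => //= _; rewrite g0.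
  rewrite [RHS](bigID (mem S)) /= [X in _ + X]big1 ?addr0 => [|c]; last first.
    by rewrite inE negbK => /eqP ->.
  rewrite cardE -(big_mkord xpredT (fun j => g (cj j) (w (cj j)))).
  by rewrite -(big_nth c0 xpredT (fun c => g c (w c))) big_enum.
move=> t; have := wB t.
rewrite (sumS _ (fun c x => x%:Z * chain_value (mv c) t)) => [|c]; last exact: mul0r.
rewrite (sumS nat (fun c x => x)) //.
rewrite -!natz natr_sum.
under [X in _ < X]eq_bigr do rewrite mulrBr; rewrite sumrB -mulr_suml.
have -> : \sum_c (w c)%:Z = \sum_c (w c)%:R by apply: eq_bigr => c _; rewrite natz.
by rewrite ltrBrDl mulrBr mulr1.
Qed.
End Certificate.

(** * Timed execution of programs *)

Lemma bitlen_gt z : (`|z| < 2 ^ bitlen z)%N.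
Proof. exact: trunc_log_ltn. Qed.

Lemma bitlen_le z N : (`|z| < 2 ^ N.+1)%N -> (bitlen z <= N.+1)%N.
Proof.
rewrite /bitlen ltnS; have [->|z0] := posnP `|z|%N; first by rewrite trunc_log0.
by move=> h; rewrite -ltnS; have := trunc_logP (isT : (1 < 2)%N) z0;
  move=> /leq_ltn_trans /(_ h); rewrite ltn_exp2l.
Qed.

Lemma bitlen_binop o u v : (bitlen (binop_eval o u v) <= (bitlen u + bitlen v).+1)%N.
Proof.
apply: bitlen_le.
have gu := bitlen_gt u; have gv := bitlen_gt v.
have pos N : (0 < 2 ^ N)%N by rewrite expn_gt0.
have hu : (`|u| < 2 ^ (bitlen u + bitlen v))%N.
  by apply: leq_trans gu _; rewrite leq_exp2l // leq_addr.
have hv : (`|v| < 2 ^ (bitlen u + bitlen v))%N.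
  by apply: leq_trans gv _; rewrite leq_exp2l // leq_addl.
rewrite expnS mul2n -addnn.
case: o => /=.
- by move: (2 ^ _)%N hu hv; lia.
- by move: (2 ^ _)%N hu hv; lia.
- rewrite abszM expnD; have := ltn_mul gu gv; lia.
- have : (`|(u %/ v)%Z| <= `|u|)%N.
    rewrite /divz; have sg : (`|sgz v| <= 1)%N by case: (sgzP v).
    move: (`|v|)%N sg => a sg {gu gv hu hv}.
    case: u => u; rewrite abszM; have := leq_div u a; move: `|sgz v|%N (u %/ a)%N sg.
      by move=> x y; rewrite /=; nia.
    by move=> x y; rewrite /=; nia.
  by move: (2 ^ _)%N hu; lia.
- have [vE|v0] := eqVneq v 0.
    have -> : (u %% v)%Z = u by rewrite vE modz0.
    by move: (2 ^ _)%N hu; lia.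
  have := ltz_mod u v0; have := modz_ge0 u v0.
  by move: (2 ^ _)%N hv; lia.
- by case: (_ <= _); have := pos (bitlen u + bitlen v)%N; lia.
- by case: (_ == _); have := pos (bitlen u + bitlen v)%N; lia.
Qed.

(** In units of [b.+1], where [2 ^ b] bounds all cells, [vbits] bounds the bit length of the value
    of an expression and [cbits] its cost. *)
Fixpoint vbits (e : expr) : nat :=
  match e with
  | Const z => bitlen z
  | Get _ _ => 1
  | Bin _ e1 e2 => (vbits e1 + vbits e2).+1
  end.

Fixpoint cbits (e : expr) : nat :=
  match e with
  | Const z => bitlen z
  | Get _ e1 => (cbits e1 + vbits e1).+1
  | Bin _ e1 e2 => cbits e1 + cbits e2 + vbits e1 + vbits e2
  end%N.

(* Up to the factor [b.+1], the time of a run in which all cells stay below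
   [2 ^ b] and every loop makes at most [b] iterations. *)
Fixpoint tbound (b : nat) (c : cmd) : nat :=
  match c with
  | Skip => 1
  | Set_ _ e1 e2 => cbits e1 + cbits e2 + vbits e1 + vbits e2
  | Seq c1 c2 => tbound b c1 + tbound b c2
  | If e c1 c2 => cbits e + tbound b c1 + tbound b c2
  | While e c1 => b * (cbits e + tbound b c1) + cbits e
  | Query _ _ => 2
  end%N.

Fixpoint mods (c : cmd) : seq nat :=
  match c with
  | Skip => [::]
  | Set_ x _ _ => [:: x]
  | Seq c1 c2 | If _ c1 c2 => mods c1 ++ mods c2
  | While _ c1 => mods c1
  | Query x _ => [:: x]
  end.

Definition agree (l : seq nat) (s s' : memory) : Prop :=
  forall y i, y \notin l -> s' y i = s y i.

Lemma agree_trans l s1 s2 s3 : agree l s1 s2 -> agree l s2 s3 -> agree l s1 s3.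
Proof. by move=> h1 h2 y i yl; rewrite h2 // h1. Qed.

Lemma agree_sub l l' s s' : {subset l <= l'} -> agree l s s' -> agree l' s s'.
Proof. by move=> ll h y i yl; rewrite h //; apply: contraNN yl; exact: ll. Qed.

Lemma agree_upd l s x i v : x \in l -> agree l s (upd s x i v).
Proof.
move=> xl y j yl; rewrite /upd; have [yx|] //= := eqVneq y x.
by rewrite yx xl in yl.
Qed.

Lemma upd_same s x i v : upd s x i v x i = v.
Proof. by rewrite /upd !eqxx. Qed.

Lemma upd_other s x i v y j : y != x -> upd s x i v y j = s y j.
Proof. by rewrite /upd => /negPf ->. Qed.

Lemma upd_cell s x i v j : j != i -> upd s x i v x j = s x j.
Proof. by rewrite /upd andbC => /negPf ->. Qed.

(** In the absence of a strict comparison, [x + 1 <= e] tests [x < e]. *)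
Definition For (x : nat) (e : expr) (c : cmd) : cmd :=
  Seq (Set_ x (Const 0) (Const 0))
    (While (Bin OpLe (Bin OpAdd (Get x (Const 0)) (Const 1)) e)
      (Seq c (Set_ x (Const 0) (Bin OpAdd (Get x (Const 0)) (Const 1))))).

Definition each (T : Type) (g : T -> cmd) (l : seq T) : cmd :=
  foldr (fun z => Seq (g z)) Skip l.

Section TimedRuns.
Variables (d : Order.disp_t) (L : finLatticeType d) (n : nat).
Variables (f : n.-tupleprod L -> int) (b : nat).

Definition bounded (s : memory) : Prop := forall x i, `|s x i| <= (2 ^ b)%N%:Z.

(** A total-correctness triple with a time bound. The bound on the cells is assumed and
    re-established, so each rule only has to check the value newly written. *)
Definition runs (c : cmd) (s : memory) (Q : memory -> Prop) : Prop :=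
  bounded s -> exists s' T, [/\ exec f c s s' T, (T <= tbound b c * b.+1)%N,
    bounded s' & Q s'].

Lemma bitlen_bounded z : `|z| <= (2 ^ b)%N%:Z -> (bitlen z <= b.+1)%N.
Proof.
move=> h; apply: bitlen_le; apply: leq_ltn_trans (_ : 2 ^ b < _)%N; last by rewrite ltn_exp2l.
by rewrite -lez_nat abszE.
Qed.

Lemma vbits_le s e : bounded s -> (bitlen (eval s e) <= vbits e * b.+1)%N.
Proof.
move=> bs; elim: e => [z|x e _|o e1 IH1 e2 IH2] /=.
- by rewrite leq_pmulr.
- by rewrite mul1n bitlen_bounded.
- apply: leq_trans (bitlen_binop _ _ _) _; rewrite mulSn mulnDl; lia.
Qed.

Lemma cbits_le s e : bounded s -> (cost s e <= cbits e * b.+1)%N.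
Proof.
move=> bs; elim: e => [z|x e IH|o e1 IH1 e2 IH2] /=.
- by rewrite leq_pmulr.
- have := vbits_le e bs; have := bitlen_bounded (bs x (eval s e)).
  by rewrite mulSn mulnDl; lia.
- have := vbits_le e1 bs; have := vbits_le e2 bs; rewrite !mulnDl; lia.
Qed.

Lemma exec_agree c s s' T : exec f c s s' T -> agree (mods c) s s'.
Proof.
elim=> {c s s' T} //=.
- by move=> x e1 e2 s; apply: agree_upd; rewrite mem_head.
- move=> c1 c2 s s1 s2 T1 T2 _ h1 _ h2; apply: agree_trans.
    by apply: agree_sub h1 => y; rewrite mem_cat => ->.
  by apply: agree_sub h2 => y; rewrite mem_cat orbC => ->.
- by move=> e c1 c2 s s1 T _ _; apply: agree_sub => y; rewrite mem_cat => ->.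
- by move=> e c1 c2 s s1 T _ _; apply: agree_sub => y; rewrite mem_cat orbC => ->.
- by move=> e c s s1 s2 T1 T2 _ _ h1 _ h2; apply: agree_trans h1 h2.
- by move=> x a s t _; apply: agree_upd; rewrite mem_head.
Qed.

Lemma runs_weaken c s (Q Q' : memory -> Prop) : runs c s Q ->
  (forall s', agree (mods c) s s' -> Q s' -> Q' s') -> runs c s Q'.
Proof.
move=> h QQ /h [s' [T [e hT bs' q]]]; exists s', T; split=> //.
exact: QQ (exec_agree e) q.
Qed.

Lemma runs_skip s (Q : memory -> Prop) : Q s -> runs Skip s Q.
Proof. by move=> q bs; exists s, 1%N; split=> //; exact: exec_Skip. Qed.

Lemma runs_set x e1 e2 s (Q : memory -> Prop) :
  `|eval s e2| <= (2 ^ b)%N%:Z -> Q (upd s x (eval s e1) (eval s e2)) ->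
  runs (Set_ x e1 e2) s Q.
Proof.
move=> h q bs; do 2!eexists; split; [exact: exec_Set| |..] => //.
  have := vbits_le e1 bs; have := vbits_le e2 bs.
  have := cbits_le e1 bs; have := cbits_le e2 bs; rewrite /= !mulnDl; lia.
by move=> y j; rewrite /upd; case: ifP.
Qed.

Lemma runs_seq c1 c2 s (Q : memory -> Prop) :
  runs c1 s (fun s1 => runs c2 s1 Q) -> runs (Seq c1 c2) s Q.
Proof.
move=> h /h [s1 [T1 [e1 hT1 b1 h2]]]; have [s2 [T2 [e2 hT2 b2 q]]] := h2 b1.
exists s2, (T1 + T2)%N; split=> //; first exact: exec_Seq e2.
by rewrite /= mulnDl leq_add.
Qed.

Lemma runs_query x a s t (Q : memory -> Prop) :
  (n <= b)%N -> `|f t| <= (2 ^ b)%N%:Z -> encodes (s a) t ->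
  Q (upd s x 0 (f t)) -> runs (Query x a) s Q.
Proof.
move=> nb fb h q bs; exists (upd s x 0 (f t)), (n + bitlen (f t))%N; split=> //.
- exact: exec_Query.
- by have := bitlen_bounded fb; rewrite /=; lia.
- by move=> y j; rewrite /upd; case: ifP.
Qed.

Lemma runs_while e c N (I : nat -> memory -> Prop) s : (N <= b)%N -> I 0%N s ->
  (forall j s', (j < N)%N -> I j s' -> eval s' e != 0 /\ runs c s' (I j.+1)) ->
  (forall s', I N s' -> eval s' e = 0) -> runs (While e c) s (I N).
Proof.
move=> Nb I0 step stop.
suff loop r j s' : (j + r = N)%N -> I j s' -> bounded s' ->
    exists s2 T, [/\ exec f (While e c) s' s2 T,
      (T <= (r * (cbits e + tbound b c) + cbits e) * b.+1)%N, bounded s2 & I N s2].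
  move=> bs; have [|s2 [T [h1 h2 h3 h4]]] := loop N 0%N s _ I0 bs; first by rewrite add0n.
  exists s2, T; split=> //; apply: leq_trans h2 _.
  by rewrite leq_mul2r /= leq_add2r leq_mul2r Nb orbT.
elim: r j s' => [|r IH] j s'.
  rewrite addn0 => -> IN bs; exists s', (cost s' e); split=> //.
    by apply: exec_WhileF; exact: stop.
  by rewrite mul0n add0n cbits_le.
move=> jr Ij bs; have [|e0 h] := step j s' _ Ij; first by lia.
have [s1 [T1 [e1 hT1 b1 I1]]] := h bs.
have [|s2 [T2 [e2 hT2 b2 I2]]] := IH j.+1 s1 _ I1 b1; first by lia.
exists s2, (cost s' e + T1 + T2)%N; split=> //; first exact: exec_WhileT e2.
by have := cbits_le e bs; rewrite mulSn !mulnDl in hT2 *; lia.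
Qed.

(** The body must establish the invariant for the memory as it is after the counter's increment. The
    frame [agree] tells the body which cells still have their values from before the loop. *)
Lemma runs_for x e c N (I : nat -> memory -> Prop) s : (N <= b)%N ->
  x \notin mods c -> I 0%N (upd s x 0 0) ->
  (forall j s', (j <= N)%N -> agree (x :: mods c) s s' -> s' x 0 = j%:Z -> I j s' ->
    eval s' e = N%:Z) ->
  (forall j s', (j < N)%N -> agree (x :: mods c) s s' -> s' x 0 = j%:Z -> I j s' ->
    runs c s' (fun s2 => I j.+1 (upd s2 x 0 j.+1%:Z))) ->
  runs (For x e c) s (fun s' => [/\ agree (x :: mods c) s s', s' x 0 = N%:Z & I N s']).
Proof.
move=> Nb xc I0 eN step; apply: runs_seq; apply: runs_set => //=.
have N2 j : (j <= N)%N -> `|j%:Z| <= (2 ^ b)%N%:Z.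
  by move=> jN; rewrite lez_nat; apply: leq_trans (ltnW (ltn_expl b (isT : (1 < 2)%N))); lia.
apply: (@runs_while _ _ N (fun j s' =>
  [/\ agree (x :: mods c) s s', s' x 0 = j%:Z & I j s'])) => //.
- by split=> //; [apply: agree_upd; rewrite mem_head | rewrite upd_same].
- move=> j s' jN [ag sx Ij] /=; split.
    by rewrite sx (eN j) ?(ltnW jN) //; move: jN; case: (leP (_ + _)) => //; lia.
  apply: runs_seq; apply: runs_weaken (step j s' jN ag sx Ij) _ => s2 ag2 I2.
  have s2x : s2 x 0 = j%:Z by rewrite ag2.
  apply: runs_set => /=; rewrite s2x -PoszD addn1; first exact: N2.
  split=> //; last by rewrite upd_same.
  apply: agree_trans ag _; apply: agree_trans (agree_sub _ ag2) _.
    by move=> y yc; rewrite inE yc orbT.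
  by apply: agree_upd; rewrite mem_head.
- move=> s' [ag sx IN] /=; rewrite sx (eN N) //.
  by case: (leP (_ + _)) => //; lia.
Qed.

Lemma runs_each (T : eqType) (g : T -> cmd) (l : seq T) (I : seq T -> memory -> Prop) s :
  I [::] s ->
  (forall l1 z l2 s', l = l1 ++ z :: l2 -> agree (mods (each g l)) s s' -> I l1 s' ->
     runs (g z) s' (I (rcons l1 z))) ->
  runs (each g l) s (I l).
Proof.
move=> I0 step.
suff gen l2 l1 s' : l = l1 ++ l2 -> agree (mods (each g l)) s s' -> I l1 s' ->
    runs (each g l2) s' (I l) by exact: (gen l [::]).
have sub l3 l4 : {subset mods (each g l4) <= mods (each g (l3 ++ l4))}.
  by elim: l3 => //= z l3 IH y /IH; rewrite mem_cat orbC => ->.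
elim: l2 l1 s' => [|z l2 IH] l1 s' ll ag Il.
  by apply: runs_skip; rewrite ll cats0.
apply: runs_seq; apply: runs_weaken (step _ _ _ _ ll ag Il) _ => s2 ag2 I2.
apply: (IH (rcons l1 z)) => //; first by rewrite ll cat_rcons.
apply: agree_trans ag (agree_sub _ ag2) => y yz; rewrite ll; apply: sub => /=.
by rewrite mem_cat yz.
Qed.

End TimedRuns.

(** * The verifier *)

(** Horner evaluation of the binary digits [g 0, ..., g l.-1], most significant first. *)
Fixpoint hor (g : nat -> bool) (l : nat) : nat :=
  if l is l'.+1 then (2 * hor g l' + g l')%N else 0%N.

Lemma hor_lt g l : (hor g l < 2 ^ l)%N.
Proof. by elim: l => //= l IH; rewrite expnS; case: (g l); lia. Qed.

Lemma eq_hor g g' l : (forall i, (i < l)%N -> g i = g' i) -> hor g l = hor g' l.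
Proof.
elim: l => //= l IH gg; rewrite gg // IH // => i il; apply: gg; exact: ltnW.
Qed.

Lemma hor_digits w N : hor (fun l => odd (w %/ 2 ^ (N - l.+1))) N = (w %% 2 ^ N)%N.
Proof.
suff gen l : (l <= N)%N ->
    hor (fun l => odd (w %/ 2 ^ (N - l.+1))) l = (w %/ 2 ^ (N - l) %% 2 ^ l)%N.
  by rewrite gen // subnn divn1.
elim: l => [|l IH] lN; first by rewrite modn1.
rewrite /= IH ?(ltnW lN) // (_ : N - l = (N - l.+1).+1)%N; last by lia.
rewrite expnSr divnMA expnS; set x := (w %/ 2 ^ (N - l.+1))%N.
have -> : (x %% (2 * 2 ^ l) = 2 * ((x %/ 2) %% 2 ^ l) + odd x)%N; last by [].
rewrite -(modn2 x) {1}(divn_eq x 2) mulnC.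
have h : (2 * (x %/ 2 %% 2 ^ l) + x %% 2 < 2 * 2 ^ l)%N.
  have := ltn_pmod (x %/ 2) (expn_gt0 2 l); have := ltn_pmod x (isT : (0 < 2)%N).
  by lia.
rewrite -[RHS](modn_small h); apply/eqP.
by rewrite eqn_modDr -!muln_modr modn_mod.
Qed.

Lemma sum_nat_ltn r N : (\sum_(0 <= j < N) (j < r) = minn r N)%N.
Proof.
elim: N => [|N IH]; first by rewrite big_nil minn0.
by rewrite big_nat_recr //= IH; case: ltnP; lia.
Qed.

Section Verifier.
Variable k : nat.
Local Notation D := (diamond k).
Local Notation K := #|{: D}|.

Definition rk (z : D) : nat := enum_rank z.

Lemma rk_lt z : (rk z < K)%N. Proof. exact: ltn_ord. Qed.

Lemma rk_inj : injective rk.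
Proof. by move=> x y /val_inj /enum_rank_inj. Qed.

Lemma K_gt0 : (0 < K)%N. Proof. by apply/card_gt0P; exists DBot. Qed.

Local Notation "e1 +e e2" := (Bin OpAdd e1 e2) (at level 50, left associativity).
Local Notation "e1 -e e2" := (Bin OpSub e1 e2) (at level 50, left associativity).
Local Notation "e1 *e e2" := (Bin OpMul e1 e2) (at level 40, left associativity).
Local Notation "e1 <=e e2" := (Bin OpLe e1 e2) (at level 70).
Local Notation "e1 =e e2" := (Bin OpEq e1 e2) (at level 70).
Local Notation "c1 ;; c2" := (Seq c1 c2) (at level 85, right associativity).
Local Notation cst z := (Const z%Z).
Local Notation num m := (Const (Posz m)).
Local Notation var x := (Get x (Const 0)).
Local Notation "x :=e e" := (Set_ x (Const 0) e) (at level 80).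

Local Notation xn := 0%N.
Local Notation xm := 1%N.
Local Notation xcert := 2%N.
Local Notation xcur := 3%N.
Local Notation xacc := 4%N.
Local Notation xi := 5%N.
Local Notation xj := 6%N.
Local Notation xlen := 7%N.
Local Notation xpow := 8%N.
Local Notation xf0 := 9%N.
Local Notation xf1 := 10%N.
Local Notation xx := 11%N.
Local Notation xv := 12%N.
Local Notation xw := 13%N.
Local Notation xtot := 14%N.
Local Notation xsum := 15%N.
Local Notation xmin := 16%N.
Local Notation xval := 17%N.
Local Notation xft := 18%N.
Local Notation xcap := 19%N.
Local Notation xl := 20%N.
Local Notation xq := 21%N.

(* The certificate is a sequence of words of [K.-1] cells; a word stands for the
   element whose rank is its number of cells equal to 1, so that every
   certificate whatsoever decodes to lattice elements. Word [4 x + r] belongs to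
   the minimiser, the point that sets the precision, the digits of the weights
   or the moves of the chains for [r] = 0, 1, 2, 3. *)
Definition word (e : expr) : expr :=
  foldr (fun j e' => (Get xcert (e *e num K.-1 +e num j) =e cst 1) +e e')
    (cst 0) (iota 0 K.-1).

Definition word_val (cert : seq bool) (q : nat) : nat :=
  (\sum_(0 <= j < K.-1) (load cert (q * K.-1 + j)%N%:Z == 1))%N.

Lemma word_val_lt cert q : (word_val cert q < K)%N.
Proof.
have := K_gt0; case KE: K => [//|K'] _; rewrite ltnS /word_val KE /=.
rewrite -[X in (_ <= X)%N](subn0 K') -[X in (_ <= X)%N]muln1 -sum_nat_const_nat.
by apply: leq_sum => j _; case: (_ == _).
Qed.

Definition word_elt (cert : seq bool) (q : nat) : D :=
  enum_val (Ordinal (word_val_lt cert q)).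

Lemma rk_word_elt cert q : rk (word_elt cert q) = word_val cert q.
Proof. by rewrite /rk enum_valK. Qed.

Lemma eval_word cert s e q : (forall i, s xcert i = load cert i) ->
  eval s e = q%:Z -> eval s (word e) = (rk (word_elt cert q))%:Z.
Proof.
move=> sc eq; rewrite rk_word_elt /word_val /word /index_iota subn0.
elim: (iota _ _) => [|j l IH] /=; first by rewrite big_nil.
by rewrite IH big_cons PoszD eq sc.
Qed.

Lemma words_exist (w : nat -> D) N : exists cert, forall q, (q < N)%N -> word_elt cert q = w q.
Proof.
(* Unary code: word [q] is [rk (w q)] ones followed by zeros. *)
pose bit p := (p %% K.-1 < rk (w (p %/ K.-1)))%N.
exists (mkseq bit (N * K.-1)) => q qN; apply: rk_inj; rewrite rk_word_elt /word_val.
have rw : (rk (w q) <= K.-1)%N by have := rk_lt (w q); lia.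
rewrite (eq_big_nat _ _ (F2 := fun j => nat_of_bool (j < rk (w q))%N)) => [|j /andP[_ jK]].
  by rewrite sum_nat_ltn; apply/minn_idPl.
have h : (q * K.-1 + j < N * K.-1)%N.
  by apply: leq_trans (_ : q.+1 * K.-1 <= _)%N; [rewrite mulSn; lia | rewrite leq_mul2r qN orbT].
rewrite /load (nth_map false) ?size_mkseq // nth_mkseq // /bit.
by rewrite divnMDl ?(leq_ltn_trans _ jK) // divn_small // addn0 modnMDl modn_small //; case: (_ < _)%N.
Qed.

(** The table of [g] becomes a sum of its entries times indicators of the arguments, of which
    exactly one is nonzero. *)
Definition lookup (g : D -> D -> D) (x y : nat) : expr :=
  foldr (fun ab e' => ((var x =e num (rk ab.1)) *e (var y =e num (rk ab.2))
                       *e num (rk (g ab.1 ab.2))) +e e')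
    (cst 0) (enum {: D * D}).

Lemma eval_lookup g x y s a b : s x 0 = (rk a)%:Z -> s y 0 = (rk b)%:Z ->
  eval s (lookup g x y) = (rk (g a b))%:Z.
Proof.
move=> sx sy.
have -> : eval s (lookup g x y) =
    \sum_(ab : D * D) (if ab == (a, b) then (rk (g a b))%:Z else 0).
  rewrite -big_enum /lookup; elim: (enum _) => [|[a' b'] l IH]; first by rewrite big_nil.
  rewrite big_cons -IH /= sx sy !eqz_nat !(inj_eq rk_inj) xpair_eqE.
  by rewrite (eq_sym a) (eq_sym b); case: eqP => [->|]; case: eqP => [->|]; rewrite ?mul0r ?mulr0 ?mul0r ?mul1r.
by rewrite -big_mkcond big_pred1_eq.
Qed.

Definition e_moves : expr := var xn *e cst 2 *e var xn.
Definition e_len : expr := e_moves +e var xn.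
Definition e_slots : expr := var xn *e num K +e cst 1.

Definition p_fill (e : expr) : cmd := For xi (var xn) (Set_ xcur (var xi) e).

Definition p_horner (x : nat) (e : expr) : cmd :=
  x :=e cst 0 ;; For xl (var xlen) (x :=e cst 2 *e var x +e e).

(* The number of digits of the weights must depend on the size of [f], which is
   unknown: the certificate supplies a point at which [|f|] is large. *)
Definition p_precision : cmd :=
  p_fill (word (cst 4 *e var xi +e cst 1)) ;; Query xf0 xcur ;;
  xcap :=e (cst 1 +e var xf0 *e var xf0) *e
           (e_slots *e (cst 2 *e e_len +e cst 3) +e cst 1) ;;
  xpow :=e cst 1 ;;
  While (var xpow <=e var xcap) (xpow :=e var xpow *e cst 2 ;; xlen :=e var xlen +e cst 1).

(** Only [xlen] digits of [m] are read, so the time does not depend on the length of [m]. Cell 0 of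
    [xm] is the sign, whence digit [i] is at address [i + 1]; cells past the end hold -1 and count
    as digit 0. *)
Definition p_target : cmd :=
  p_horner xval (Get xm (var xlen -e var xl) =e cst 1) ;;
  p_fill (word (cst 4 *e var xi)) ;; Query xft xcur.

(** Flattens the table indexed by coordinate and value in which the weighted gains of all chains are
    accumulated. *)
Definition e_acc (z : D) : expr := var xi *e num K +e num (rk z).

Definition p_gain (z : D) : cmd :=
  Set_ xcur (var xi) (lookup (fun x y => slope x y z) xx xv) ;;
  Query xf1 xcur ;;
  Set_ xacc (e_acc z) (Get xacc (e_acc z) +e var xw *e (var xf1 -e var xf0)).

(** From move [e_moves] on, the arithmetic in [xv] overrides the certificate by [DTop]. Every
    certificate thus describes chains that reach the top, as soundness requires. *)
Definition p_move : cmd :=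
  xi :=e Bin OpMod (var xq) (var xn) ;;
  xx :=e Get xcur (var xi) ;;
  xv :=e num (rk DTop) +e (var xq +e cst 1 <=e e_moves) *e
         (word (cst 4 *e (var xj *e e_len +e var xq) +e cst 3) -e num (rk DTop)) ;;
  Query xf0 xcur ;;
  each p_gain (enum {: D}) ;;
  Set_ xcur (var xi) (lookup (fun x y => (x `|` y)%O) xx xv).

Definition p_chain : cmd :=
  p_horner xw (word (cst 4 *e (var xj *e var xlen +e var xl) +e cst 2) =e num (rk DTop)) ;;
  xtot :=e var xtot +e var xw ;;
  p_fill (num (rk DBot)) ;; Query xf0 xcur ;;
  xsum :=e var xsum +e var xw *e var xf0 ;;
  For xq e_len p_move.

Definition p_min (z : D) : cmd :=
  xmin :=e var xmin +e (Get xacc (e_acc z) -e var xmin) *e (Get xacc (e_acc z) <=e var xmin).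

Definition p_minimum : cmd :=
  xmin :=e Get xacc (e_acc DBot) ;; each p_min (enum {: D}) ;;
  xsum :=e var xsum +e var xmin.

Definition p_minima : cmd := For xi (var xn) p_minimum.

Definition e_target : expr := (cst 1 -e cst 2 *e Get xm (cst 0)) *e var xval.

(** The three factors of the answer: [m] has no digits beyond those read; [m] is the value of [f] at
    the proposed minimiser; the minimum of the weighted separable bound exceeds [xtot * (m - 1)],
    which by integrality excludes values below [m]. *)
Definition verifier : cmd :=
  p_precision ;; p_target ;; For xj e_slots p_chain ;; p_minima ;;
  xn :=e (Get xm (var xlen +e cst 1) =e cst (-1)) *e (e_target =e var xft) *e
         (var xtot *e (e_target -e cst 1) +e cst 1 <=e var xsum).


(** * Correctness and cost of the verifier *)

Section Run.
Variables (n : nat) (n_gt0 : (0 < n)%N) (f : n.-tupleprod D -> int).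
Variables (m : int) (cert : seq bool) (F b : nat).
Hypothesis Ff : forall t, `|f t| <= F%:Z.

Definition len : nat := (moves n + n)%N.
(** The precision needed in [certificate_exists] for values of size [u], with [1 + u * u] in place
    of [u] because the programs compute no absolute values. It also dominates [u] itself, so that
    [m] fits into the digits. *)
Definition cap_of (u : nat) : nat :=
  ((1 + u * u) * (slots k n * (2 * len + 3) + 1))%N.
Definition Ymax : nat := (2 * cap_of F)%N.
Hypothesis nb : (n <= b)%N.
Hypothesis lenb : (len <= b)%N.
Hypothesis slotsb : (slots k n <= b)%N.
Hypothesis sizeb :
  (K * n.+1 * slots k n * len.+1 * Ymax * (2 * F).+1 <= 2 ^ b)%N.

Local Notation coord := (coord n_gt0).
Local Notation cur := (@cur k n n_gt0).
Local Notation gain := (gain n_gt0 f).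
Local Notation bot := (bot_tuple k n).
Local Notation runs := (runs f b).

Lemma cap_gt0 u : (0 < cap_of u)%N.
Proof. by rewrite muln_gt0 addn1 andbT. Qed.

Lemma Kb : (K <= 2 ^ b)%N.
Proof.
by apply: leq_trans sizeb; rewrite -!mulnA leq_pmulr // !muln_gt0 /= ?addn1.
Qed.

Lemma accb : (slots k n * len.+1 * Ymax * (2 * F).+1 * n.+1 <= 2 ^ b)%N.
Proof.
apply: leq_trans sizeb.
have -> : (K * n.+1 * slots k n * len.+1 * Ymax * (2 * F).+1 =
  K * (slots k n * len.+1 * Ymax * (2 * F).+1 * n.+1))%N by ring.
by rewrite leq_pmull // K_gt0.
Qed.

Lemma Fb : (F <= 2 ^ b)%N.
Proof.
apply: leq_trans accb; apply: leq_trans (leq_pmulr _ (ltn0Sn n)).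
apply: leq_trans (leq_pmull _ _); last by rewrite !muln_gt0 /= ?addn1.
by lia.
Qed.

Lemma slotsYb : (slots k n * Ymax <= 2 ^ b)%N.
Proof.
apply: leq_trans accb.
have -> : (slots k n * len.+1 * Ymax * (2 * F).+1 * n.+1 =
  slots k n * Ymax * (len.+1 * (2 * F).+1 * n.+1))%N by ring.
by rewrite leq_pmulr.
Qed.

Lemma Yb : (Ymax <= 2 ^ b)%N.
Proof. by apply: leq_trans slotsYb; rewrite leq_pmull. Qed.

Lemma fb t : `|f t| <= (2 ^ b)%N%:Z.
Proof. by apply: le_trans (Ff t) _; rewrite lez_nat Fb. Qed.

Lemma rkb z : `|(rk z)%:Z| <= (2 ^ b)%N%:Z.
Proof. by rewrite lez_nat; apply: leq_trans (ltnW (rk_lt z)) Kb. Qed.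

Lemma natb x : (x <= b)%N -> `|x%:Z| <= (2 ^ b)%N%:Z.
Proof.
by move=> h; rewrite lez_nat; apply: leq_trans (ltnW (ltn_expl b (isT : (1 < 2)%N))).
Qed.

Definition tupf (g : nat -> D) : n.-tupleprod D := [tuple g i | i < n].

Lemma fill_runs e g s : s xn 0 = n%:Z ->
  (forall i s', (i < n)%N -> agree [:: xi; xcur] s s' -> s' xi 0 = i%:Z ->
     eval s' e = (rk (g i))%:Z) ->
  runs (p_fill e) s (fun s' => encodes (s' xcur) (tupf g)).
Proof.
move=> sn he.
apply: runs_weaken (@runs_for _ _ _ f b xi (var xn) _ n
  (fun i s' => forall l, (l < i)%N -> s' xcur l%:Z = (rk (g l))%:Z) s nb _ _ _ _) _ => //.
- by move=> i s' _ ag _ _; rewrite /= ag // sn.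
- move=> i s' iN ag si Ii; have ei := he i s' iN ag si.
  apply: runs_set; rewrite /= ei ?rkb // si => l; rewrite /upd /= ltnS leq_eqVlt eqz_nat.
  by case: eqP => [-> //|_] /=; exact: Ii.
- by move=> s' _ [_ _ h] i; rewrite h // tnth_mktuple.
Qed.

Lemma horner_runs x e g s N : x \notin [:: xlen; xl] -> s xlen 0 = N%:Z ->
  (N <= b)%N ->
  (forall l s', (l < N)%N -> agree [:: xl; x] s s' -> s' xl 0 = l%:Z ->
     eval s' e = (nat_of_bool (g l))%:Z) ->
  runs (p_horner x e) s (fun s' => s' x 0 = (hor g N)%:Z).
Proof.
rewrite !inE negb_or => /andP[x7 x20] sN Nb he.
apply: runs_seq; apply: runs_set => //=; set s1 := upd s x 0 0.
have ag1 : agree [:: xl; x] s s1 by apply: agree_upd; rewrite !inE eqxx orbT.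
apply: runs_weaken (@runs_for _ _ _ f b xl (var xlen) _ N
  (fun l s' => s' x 0 = (hor g l)%:Z) s1 Nb _ _ _ _) _ => //.
- by rewrite inE eq_sym.
- by rewrite upd_other // /s1 upd_same.
- have lx : xlen \notin [:: xl; x] by rewrite !inE (eq_sym _ x) (negPf x7).
  by move=> l s' _ ag _ _; rewrite /= ag ?ag1.
- move=> l s' lN ag sl sx; have el := he l s' lN (agree_trans ag1 ag) sl.
  apply: runs_set; rewrite /= el sx -PoszM -PoszD.
    rewrite lez_nat -[X in (X <= _)%N]/(hor g l.+1).
    by apply: leq_trans (ltnW (hor_lt _ _)) _; rewrite leq_exp2l //; lia.
  by rewrite upd_other // upd_same.
- by move=> s' _ [].
Qed.

Definition goal_pt : n.-tupleprod D := tupf (fun i => word_elt cert (4 * i)).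
Definition prec_pt : n.-tupleprod D := tupf (fun i => word_elt cert (4 * i + 1)).
Definition cap : nat := cap_of `|f prec_pt|.
Definition digits : nat := (trunc_log 2 cap).+1.

Lemma cap_lt : (cap < 2 ^ digits)%N. Proof. exact: trunc_log_ltn. Qed.

Lemma pow_le_cap j : (j < digits)%N -> (2 ^ j <= cap)%N.
Proof.
move=> h; apply: leq_trans (trunc_logP (isT : (1 < 2)%N) (cap_gt0 _)).
by rewrite leq_exp2l.
Qed.

Lemma cap_le : (cap <= cap_of F)%N.
Proof.
rewrite leq_mul2r; apply/orP; right; rewrite leq_add2l.
by rewrite leq_mul // -lez_nat abszE Ff.
Qed.

Lemma pow_digits : (2 ^ digits <= Ymax)%N.
Proof.
by rewrite expnS leq_mul2l /=; apply: leq_trans (pow_le_cap (ltnSn _)) cap_le.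
Qed.

Lemma digitsb : (digits <= b)%N.
Proof.
by rewrite -(@leq_exp2l 2) //; apply: leq_trans pow_digits Yb.
Qed.

Lemma capb : (cap <= 2 ^ b)%N.
Proof. by apply: leq_trans (ltnW cap_lt) (leq_trans pow_digits Yb). Qed.

Lemma eval_moves s : s xn 0 = n%:Z -> eval s e_moves = (moves n)%:Z.
Proof. by move=> /= ->; rewrite -!PoszM; congr Posz; rewrite /moves; lia. Qed.

Lemma eval_len s : s xn 0 = n%:Z -> eval s e_len = len%:Z.
Proof. by move=> sn; rewrite /len PoszD -(eval_moves sn) /= sn. Qed.

Lemma eval_slots s : s xn 0 = n%:Z -> eval s e_slots = (slots k n)%:Z.
Proof. by move=> /= ->; rewrite -PoszM -PoszD addn1. Qed.

Lemma precision_runs s : s xn 0 = n%:Z -> (forall i, s xcert i = load cert i) ->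
  s xlen 0 = 0 -> runs p_precision s (fun s' => s' xlen 0 = digits%:Z).
Proof.
move=> sn sc sl; apply: runs_seq.
apply: runs_weaken (fill_runs (g := fun i => word_elt cert (4 * i + 1)) sn _) _.
  move=> i s' iN ag si; apply: eval_word => [p|]; first by rewrite ag.
  by rewrite /= si -PoszM -PoszD.
move=> s1 ag1 enc; apply: runs_seq; apply: (runs_query nb (fb _) enc) => //.
set s2 := upd _ _ _ _.
have s2n : s2 xn 0 = n%:Z by rewrite /s2 /upd /= ag1.
apply: runs_seq.
have capE : eval s2 ((cst 1 +e var xf0 *e var xf0) *e
           (e_slots *e (cst 2 *e e_len +e cst 3) +e cst 1)) = cap%:Z.
  rewrite [LHS]/= -/(eval s2 e_len) -/(eval s2 e_slots).
  have := eval_len s2n; have := eval_slots s2n => /= -> ->.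
  rewrite /cap /cap_of /s2 upd_same.
  have sq : f prec_pt * f prec_pt = (`|f prec_pt| * `|f prec_pt|)%N%:Z.
    by rewrite -abszM gez0_abs // -expr2 sqr_ge0.
  by rewrite sq -!(PoszM, PoszD).
apply: runs_set; rewrite capE /=; first by rewrite lez_nat capb.
set s3 := upd _ _ _ _.
apply: runs_seq; apply: runs_set => //=; first exact: (natb (leq_trans n_gt0 nb)).
set s4 := upd _ _ _ _.
have s40 : [/\ s4 xpow 0 = 1, s4 xlen 0 = 0 & s4 xcap 0 = cap%:Z].
  by rewrite /s4 /s3 /s2 /upd /= ag1.
(* [xpow] is [2 ^ j] after [j] iterations and first exceeds [cap] at [j = digits]. *)
apply: runs_weaken (@runs_while _ _ _ f b (var xpow <=e var xcap) _ digits
  (fun j s' => [/\ s' xpow 0 = (2 ^ j)%N%:Z, s' xlen 0 = j%:Z & s' xcap 0 = cap%:Z])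
  s4 digitsb s40 _ _) _.
- move=> j s' jd [hp hl hc]; have pc := pow_le_cap jd.
  split; first by rewrite /= hp hc lez_nat pc.
  have j2 : (2 ^ j * 2 <= 2 ^ b)%N.
    by rewrite -expnSr leq_exp2l // (leq_trans jd digitsb).
  apply: runs_seq; apply: runs_set; rewrite /= hp -PoszM; first by rewrite lez_nat.
  apply: runs_set; rewrite /= /upd /= hl -PoszD addn1.
    exact: natb (leq_trans jd digitsb).
  by rewrite expnSr.
- by move=> s' [hp _ hc]; rewrite /= hp hc lez_nat leqNgt cap_lt.
- by move=> s' _ [].
Qed.

(** The shift by one skips the sign; past the end the cell is -1 and the binary digit is 0, so both
    sides are false. *)
Lemma load_digit i : (load (int_bits m) i.+1%:Z == 1) = odd (`|m| %/ 2 ^ i).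
Proof.
rewrite -[LHS]/(nth (-1) [seq (nat_of_bool x)%:Z |
  x <- mkseq (fun i => odd (`|m| %/ 2 ^ i)) (bitlen m)] i == 1).
have [h|h] := ltnP i (bitlen m).
  by rewrite (nth_map false) ?size_mkseq // nth_mkseq //; case: (odd _).
rewrite nth_default; last by rewrite size_map size_mkseq.
rewrite divn_small //.
by apply: leq_trans (bitlen_gt m) _; rewrite leq_exp2l.
Qed.

Lemma target_runs s : s xn 0 = n%:Z -> (forall i, s xcert i = load cert i) ->
  (forall i, s xm i = load (int_bits m) i) -> s xlen 0 = digits%:Z ->
  runs p_target s (fun s' => s' xval 0 = (`|m| %% 2 ^ digits)%N%:Z
    /\ s' xft 0 = f goal_pt).
Proof.
move=> sn sc sm sl; apply: runs_seq.
apply: runs_weaken (horner_runs (N := digits)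
    (g := fun l => odd (`|m| %/ 2 ^ (digits - l.+1))) _ sl digitsb _) _ => //.
  move=> l s' lN ag sl'; rewrite /= sl' !ag // sl sm subzn ?(ltnW lN) //.
  by rewrite -[in (digits - l)%N](subnSK lN) load_digit.
move=> s1 ag1 s1v; apply: runs_seq.
apply: runs_weaken (fill_runs (g := fun i => word_elt cert (4 * i)) _ _) _.
- by rewrite ag1.
- move=> i s' iN ag si; apply: eval_word => [p|]; first by rewrite ag // ag1.
  by rewrite /= si -PoszM.
move=> s2 ag2 enc; apply: (runs_query nb (fb _) enc).
by rewrite /upd /= ag2 // s1v hor_digits.
Qed.

Definition mv (j q : nat) : D :=
  if (q < moves n)%N then word_elt cert (4 * (j * len + q) + 3) else DTop.

Definition wt (j : nat) : nat :=
  hor (fun l => word_elt cert (4 * (j * digits + l) + 2) == DTop) digits.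

(** The contribution of coordinate [i] with value [z] to the separable bound after [q] moves of
    chain [j]. *)
Definition hsum (j q i : nat) (z : D) : int :=
  \sum_(r < q | (r %% n == i)%N) gain (mv j) r z.

Definition accv (j i : nat) (z : D) : int :=
  \sum_(j' < j) (wt j')%:Z * hsum j' len i z.

Lemma wt_lt j : (wt j < 2 ^ digits)%N. Proof. exact: hor_lt. Qed.

Lemma wt_le j : (wt j <= Ymax)%N.
Proof. exact: leq_trans (ltnW (wt_lt j)) pow_digits. Qed.

Lemma gain_abs v q z : `|gain v q z| <= (2 * F)%N%:Z.
Proof. by apply: le_trans (ler_normB _ _) _; rewrite mul2n -addnn PoszD lerD. Qed.

Lemma wt_gain_abs j q z : `|(wt j)%:Z * gain (mv j) q z| <= (Ymax * (2 * F))%N%:Z.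
Proof. by rewrite normrM PoszM ler_pM // ?gain_abs // lez_nat wt_le. Qed.

Lemma wt_hsum_abs j q i z :
  `|(wt j)%:Z * hsum j q i z| <= (q * (Ymax * (2 * F)))%N%:Z.
Proof.
rewrite mulr_sumr; apply: le_trans (ler_norm_sum _ _ _) _; rewrite big_mkcond /=.
apply: le_trans (_ : \sum_(r < q) (Ymax * (2 * F))%N%:Z <= _).
  by apply: ler_sum => r _; case: ifP => // _; exact: wt_gain_abs.
by rewrite sumr_const card_ord -mulr_natr natz -PoszM mulnC.
Qed.

Lemma accv_abs j i z : `|accv j i z| <= (j * (len * (Ymax * (2 * F))))%N%:Z.
Proof.
apply: le_trans (ler_norm_sum _ _ _) _.
apply: le_trans (_ : \sum_(r < j) (len * (Ymax * (2 * F)))%N%:Z <= _).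
  by apply: ler_sum => r _; exact: wt_hsum_abs.
by rewrite sumr_const card_ord -mulr_natr natz -PoszM mulnC.
Qed.

Lemma encodes_upt a (t : n.-tupleprod D) (i : 'I_n) y :
  (forall l : 'I_n, l != i -> a (l : nat)%:Z = (rk (tnth t l))%:Z) ->
  a (i : nat)%:Z = (rk y)%:Z -> encodes a (upt t i y).
Proof.
by move=> h hi l; rewrite tnth_upt; case: eqP => [->//|/eqP /h ->].
Qed.

Lemma idx_inj i i' z z' : (i * K + rk z = i' * K + rk z')%N -> i = i' /\ z = z'.
Proof.
move=> h; have := congr1 (divn^~ K) h; have := congr1 (modn^~ K) h.
rewrite !modnMDl !divnMDl ?K_gt0 // !modn_small ?rk_lt // !divn_small ?rk_lt //.
by rewrite !addn0 => /rk_inj.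
Qed.

Lemma mods_each (T : Type) (g : T -> cmd) l (M : seq nat) :
  (forall z, {subset mods (g z) <= M}) -> {subset mods (each g l) <= M}.
Proof.
move=> gM; elim: l => //= z l IH y.
by rewrite mem_cat => /orP[/gM|/IH].
Qed.

Lemma eval_acc s i z : s xi 0 = i%:Z -> eval s (e_acc z) = (i * K + rk z)%N%:Z.
Proof. by move=> /= ->; rewrite -PoszM -PoszD. Qed.

Lemma move_runs j q s (A : nat -> D -> int) : (q < len)%N ->
  s xn 0 = n%:Z -> (forall i, s xcert i = load cert i) ->
  s xj 0 = j%:Z -> s xq 0 = q%:Z -> s xw 0 = (wt j)%:Z ->
  encodes (s xcur) (cur (mv j) q) ->
  (forall i z, (i < n)%N -> s xacc (i * K + rk z)%N%:Z = A i z) ->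
  (forall i z, `|A i z| + (Ymax * (2 * F))%N%:Z <= (2 ^ b)%N%:Z) ->
  runs p_move s (fun s' => encodes (s' xcur) (cur (mv j) q.+1) /\
    forall i z, (i < n)%N -> s' xacc (i * K + rk z)%N%:Z =
      A i z + (if (q %% n == i)%N then (wt j)%:Z * gain (mv j) q z else 0)).
Proof.
move=> ql sn sc sj sq sw enc sacc Ab.
set i := (q %% n)%N; have iN : (i < n)%N by rewrite ltn_pmod.
set x := tnth (cur (mv j) q) (coord q).
have lne (l : 'I_n) : l != coord q -> (l : nat)%:Z != i%:Z.
  by rewrite eqz_nat -(inj_eq val_inj).
apply: runs_seq; apply: runs_set; rewrite /= sq sn modz_nat.
  exact: natb (ltnW (leq_trans iN nb)).
set s1 := upd _ _ _ _; apply: runs_seq.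
have s1x : eval s1 (Get xcur (var xi)) = (rk x)%:Z by rewrite /= /s1 /upd /= (enc (coord q)).
apply: runs_set; rewrite s1x; first exact: rkb.
set s2 := upd _ _ _ _; apply: runs_seq.
have s2n : s2 xn 0 = n%:Z by [].
have s2v : eval s2 (num (rk (@DTop k)) +e (var xq +e cst 1 <=e e_moves) *e
    (word (cst 4 *e (var xj *e e_len +e var xq) +e cst 3) -e num (rk (@DTop k)))) =
    (rk (mv j q))%:Z.
  have wordE : eval s2 (word (cst 4 *e (var xj *e e_len +e var xq) +e cst 3)) =
      (rk (word_elt cert (4 * (j * len + q) + 3)))%:Z.
    apply: eval_word => //; have /= := eval_len s2n => ->.
    by rewrite /s2 /s1 /upd /= sj sq -!(PoszM, PoszD).
  have /= := eval_moves s2n => ->; rewrite wordE.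
  rewrite /s2 /s1 /upd /= sq -PoszD addn1 lez_nat /mv.
  by case: ifP => _; rewrite ?mul1r ?mul0r ?addr0 // addrC subrK.
apply: runs_set; rewrite s2v; first exact: rkb.
set s3 := upd _ _ _ _.
apply: runs_seq; apply: (runs_query nb (fb (cur (mv j) q))) => //.
set s4 := upd _ _ _ _; apply: runs_seq.
have modsM : {subset mods (each p_gain (enum {: D})) <= [:: xcur; xf1; xacc]}.
  by apply: mods_each => z y.
(* The moved coordinate of [xcur] is left unspecified, since every [p_gain] overwrites it; only the
   accumulators of values already treated have changed. *)
pose I (l1 : seq D) (s' : memory) :=
  (forall l : 'I_n, l != coord q -> s' xcur (l : nat)%:Z = (rk (tnth (cur (mv j) q) l))%:Z)
  /\ (forall i' z, (i' < n)%N -> s' xacc (i' * K + rk z)%N%:Z =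
      A i' z + (if (i == i') && (z \in l1) then (wt j)%:Z * gain (mv j) q z else 0)).
apply: runs_weaken (@runs_each _ _ _ f b _ p_gain (enum {: D}) I s4 _ _) _.
- split=> [l _|i' z i'N]; first by rewrite /s4 /s3 /s2 /s1 /upd /= enc.
  by rewrite /s4 /s3 /s2 /s1 /upd /= andbF addr0 sacc.
- move=> l1 z l2 s' lE ag [Icur Iacc].
  have {}ag : agree [:: xcur; xf1; xacc] s4 s' by apply: agree_sub ag.
  have hx : s' xx 0 = (rk x)%:Z by rewrite ag.
  have hv : s' xv 0 = (rk (mv j q))%:Z by rewrite ag.
  have hi : s' xi 0 = i%:Z by rewrite ag.
  apply: runs_seq; apply: runs_set; rewrite (eval_lookup _ hx hv); first exact: rkb.
  rewrite [eval _ _]/= hi; set s5 := upd _ _ _ _; apply: runs_seq.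
  have enc5 : encodes (s5 xcur) (upt (cur (mv j) q) (coord q) (slope x (mv j q) z)).
    apply: encodes_upt => [l li|]; last by rewrite /s5 upd_same.
    by rewrite /s5 (upd_cell _ _ _ (lne l li)); exact: Icur.
  apply: (runs_query nb (fb _) enc5); set s6 := upd _ _ _ _.
  have hi6 : s6 xi 0 = i%:Z by rewrite /s6 /s5 /upd.
  have newE : eval s6 (Get xacc (e_acc z) +e var xw *e (var xf1 -e var xf0)) =
      A i z + (wt j)%:Z * gain (mv j) q z.
    have /= := eval_acc z hi6 => ->.
    have -> : s6 xw 0 = (wt j)%:Z by rewrite /s6 /s5 /upd /= ag.
    have -> : s6 xf0 0 = f (cur (mv j) q) by rewrite /s6 /s5 /upd /= ag.
    have -> : s6 xf1 0 = f (upt (cur (mv j) q) (coord q) (slope x (mv j q) z)) by [].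
    have -> : s6 xacc (i * K + rk z)%N%:Z = s' xacc (i * K + rk z)%N%:Z by [].
    (* Each value is enumerated once, so its accumulator is still untouched. *)
    have zl1 : z \notin l1.
      have := enum_uniq {: D}; rewrite lE cat_uniq /= => /and3P[_ + _].
      by rewrite negb_or => /andP[].
    by rewrite Iacc // eqxx /= (negPf zl1) addr0.
  apply: runs_set; rewrite newE ?(eval_acc _ hi6).
    apply: le_trans (ler_normD _ _) _; apply: le_trans (Ab i z).
    by rewrite lerD2l wt_gain_abs.
  split=> [l li|i' z' i'N]; first by rewrite upd_other // /s6 upd_other // /s5 (upd_cell _ _ _ (lne l li)); exact: Icur.
  rewrite mem_rcons inE /upd /= eqz_nat; case: eqP => [/idx_inj[-> ->]|ne].
    by rewrite !eqxx.
  rewrite -[s6 _ _]/(s' xacc _) Iacc //; congr (_ + _).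
  case: (i =P i') => //= ii; case: (z' =P z) => //= zz.
  by case: ne; rewrite ii zz.
- move=> s7 ag [Icur Iacc].
  have {}ag : agree [:: xcur; xf1; xacc] s4 s7 by apply: agree_sub ag.
  have hx : s7 xx 0 = (rk x)%:Z by rewrite ag.
  have hv : s7 xv 0 = (rk (mv j q))%:Z by rewrite ag.
  have hi : s7 xi 0 = i%:Z by rewrite ag.
  apply: runs_set; rewrite (eval_lookup _ hx hv); first exact: rkb.
  rewrite [eval _ _]/= hi; split=> [|i' z i'N].
    apply: encodes_upt => [l li|]; last by rewrite upd_same.
    by rewrite (upd_cell _ _ _ (lne l li)); exact: Icur.
  by rewrite upd_other // Iacc // mem_enum inE andbT.
Qed.

Definition tot (j : nat) : nat := (\sum_(j' < j) wt j')%N.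

Definition base_sum (j : nat) : int := \sum_(j' < j) (wt j')%:Z * f bot.

Definition chain_state (j : nat) (s : memory) : Prop :=
  [/\ s xtot 0 = (tot j)%:Z, s xsum 0 = base_sum j
    & forall i z, (i < n)%N -> s xacc (i * K + rk z)%N%:Z = accv j i z].

Lemma tot_le j : (j <= slots k n)%N -> (tot j <= 2 ^ b)%N.
Proof.
move=> h; apply: leq_trans slotsYb; apply: leq_trans (_ : \sum_(j' < j) Ymax <= _)%N.
  by apply: leq_sum => j' _; exact: wt_le.
by rewrite sum_nat_const card_ord leq_mul2r h orbT.
Qed.

Lemma base_sum_abs j : `|base_sum j| <= (j * (Ymax * F))%N%:Z.
Proof.
apply: le_trans (ler_norm_sum _ _ _) _.
apply: le_trans (_ : \sum_(r < j) (Ymax * F)%N%:Z <= _).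
  by apply: ler_sum => r _; rewrite normrM PoszM ler_pM // lez_nat wt_le.
by rewrite sumr_const card_ord -mulr_natr natz -PoszM mulnC.
Qed.

Lemma sumsb : (slots k n * (Ymax * F) + n * (slots k n * (len * (Ymax * (2 * F)))) <= 2 ^ b)%N.
Proof.
apply: leq_trans accb; move: (slots k n) Ymax len => a y l.
have -> : (a * (y * F) + n * (a * (l * (y * (2 * F)))) = a * y * (F + n * l * (2 * F)))%N.
  by ring.
have -> : (a * l.+1 * y * (2 * F).+1 * n.+1 = a * y * (l.+1 * (2 * F).+1 * n.+1))%N by ring.
by rewrite leq_mul2l; apply/orP; right; nia.
Qed.

Lemma accsb : (slots k n * (len * (Ymax * (2 * F))) <= 2 ^ b)%N.
Proof.
apply: leq_trans sumsb; apply: leq_trans (leq_addl _ _).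
by rewrite leq_pmull.
Qed.

Lemma hsumS j q i z : hsum j q.+1 i z =
  hsum j q i z + (if (q %% n == i)%N then gain (mv j) q z else 0).
Proof. by rewrite /hsum big_mkcond big_ord_recr /= -big_mkcond. Qed.

Definition move_vars : seq nat := [:: xi; xx; xv; xf0; xcur; xf1; xacc].

Lemma mods_p_move : {subset mods p_move <= move_vars}.
Proof.
have gM : {subset mods (each p_gain (enum {: D})) <= [:: xcur; xf1; xacc]}.
  by apply: mods_each => z y.
move=> y; rewrite /= !inE mem_cat => /or4P[/eqP->//|/eqP->//|/eqP->//|].
case/or3P => [/eqP->//|/gM|]; rewrite !inE; last by move/eqP->.
by case/or3P => /eqP ->.
Qed.

Lemma move_sub : {subset xq :: mods p_move <= xq :: move_vars}.
Proof. by move=> y; rewrite inE => /orP[/eqP->|/mods_p_move h]; rewrite ?mem_head // inE h orbT. Qed.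

Lemma for_sub : {subset mods (For xq e_len p_move) <= xq :: move_vars}.
Proof.
move=> y; rewrite -[mods _]/(xq :: mods p_move ++ [:: xq]) inE mem_cat mem_seq1.
by case/or3P => [/eqP->|/mods_p_move h|/eqP->]; rewrite ?mem_head // inE h orbT.
Qed.

Lemma chain_runs j s : (j < slots k n)%N ->
  s xn 0 = n%:Z -> (forall i, s xcert i = load cert i) ->
  s xlen 0 = digits%:Z -> s xj 0 = j%:Z -> chain_state j s ->
  runs p_chain s (chain_state j.+1).
Proof.
move=> jN sn sc sl sj [st ss sa]; apply: runs_seq.
apply: runs_weaken (horner_runs (N := digits)
    (g := fun l => word_elt cert (4 * (j * digits + l) + 2) == DTop) _ sl digitsb _) _ => //.
  move=> l s' lN ag sl'.
  have wE : eval s' (word (cst 4 *e (var xj *e var xlen +e var xl) +e cst 2)) =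
      (rk (word_elt cert (4 * (j * digits + l) + 2)))%:Z.
    apply: eval_word => [p|]; first by rewrite ag.
    by rewrite /= sl' !ag // sj sl -!(PoszM, PoszD).
  by rewrite /= wE eqz_nat (inj_eq rk_inj).
move=> s1 ag1 s1w; apply: runs_seq.
have totE : eval s1 (var xtot +e var xw) = (tot j.+1)%:Z.
  by rewrite /= s1w ag1 // st -PoszD /tot big_ord_recr.
apply: runs_set; rewrite totE; first by rewrite lez_nat tot_le.
set s2 := upd _ _ _ _; apply: runs_seq.
apply: runs_weaken (fill_runs (g := fun=> DBot) _ _) _ => //.
  by rewrite /s2 /upd /= ag1.
move=> s3 ag3 enc3; apply: runs_seq.
apply: (runs_query nb (fb bot) enc3); set s4 := upd _ _ _ _; apply: runs_seq.
have sumE : eval s4 (var xsum +e var xw *e var xf0) = base_sum j.+1.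
  rewrite /= /s4 /upd /= !ag3 // /s2 /upd /= s1w !ag1 // ss.
  by rewrite /base_sum big_ord_recr.
apply: runs_set; rewrite sumE.
  apply: le_trans (base_sum_abs _) _; rewrite lez_nat.
  apply: leq_trans sumsb; apply: leq_trans (leq_addr _ _).
  by rewrite leq_mul2r jN orbT.
set s5 := upd _ _ _ _.
have s5E y i : y \notin [:: xsum; xf0; xcur; xi; xtot; xw; xl] -> s5 y i = s y i.
  rewrite !inE !negb_or => /and5P[h1 h2 h3 h4 /and3P[h5 h6 h7]].
  rewrite /s5 upd_other // /s4 upd_other // ag3 ?inE ?negb_or ?h3 ?h4 //.
  by rewrite /s2 upd_other // ag1 // !inE !negb_or h6 h7.
have s5n : s5 xn 0 = n%:Z by rewrite s5E.
apply: runs_weaken (@runs_for _ _ _ f b xq e_len p_move len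
  (fun q s' => encodes (s' xcur) (cur (mv j) q) /\
     forall i z, (i < n)%N -> s' xacc (i * K + rk z)%N%:Z =
       accv j i z + (wt j)%:Z * hsum j q i z) s5 lenb _ _ _ _) _ => //.
- by apply/negP => /mods_p_move.
- by split=> // i z iN; rewrite upd_other // s5E // sa // /hsum big_ord0 mulr0 addr0.
- move=> q s' _ /(agree_sub move_sub) ag _ _.
  by apply: eval_len; rewrite ag.
- move=> q s' qN /(agree_sub move_sub) ag sq [enc sacc].
  apply: runs_weaken (@move_runs j q s'
    (fun i z => accv j i z + (wt j)%:Z * hsum j q i z) qN _ _ _ sq _ enc sacc _) _.
  + by rewrite ag.
  + by move=> i; rewrite ag // s5E.
  + by rewrite ag // s5E.
  + by rewrite ag // /s5 /s4 /upd /= ag3 // /s2 /upd /= s1w.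
  + move=> i z; apply: le_trans (lerD (ler_normD _ _) (lexx _)) _.
    apply: le_trans (lerD (lerD (accv_abs _ _ _) (wt_hsum_abs _ _ _ _)) (lexx _)) _.
    rewrite -!PoszD lez_nat; apply: leq_trans accsb.
    apply: leq_trans (_ : j.+1 * (len * (Ymax * (2 * F))) <= _)%N; last by rewrite leq_mul2r jN orbT.
    by rewrite [(j.+1 * _)%N]mulSnr -addnA leq_add2l -mulSnr leq_mul2r qN orbT.
  + move=> s6 _ [enc6 acc6]; split=> // i z iN; rewrite upd_other // acc6 // hsumS.
    by rewrite -addrA; congr (_ + _); case: ifP => _; rewrite ?addr0 // [RHS]mulrDr.
- move=> s6 /(agree_sub for_sub) ag6 [_ _ [_ acc6]]; split.
  + by rewrite ag6 // /s5 /s4 /upd /= ag3 // /s2 /upd.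
  + by rewrite ag6 // /s5 /upd.
  + by move=> i z iN; rewrite acc6 // /accv big_ord_recr.
Qed.

Lemma mods_p_chain : {subset mods p_chain <=
  [:: xq, xw, xl, xtot, xsum & move_vars]}.
Proof.
have pE : mods p_chain = [:: xw; xl; xw; xl; xtot; xi; xcur; xi; xf0; xsum] ++
  mods (For xq e_len p_move) by [].
move=> y; rewrite pE mem_cat => /orP[|/for_sub].
  by rewrite !inE; do !case/orP => [/eqP->//|]; move/eqP->.
by rewrite inE => /orP[/eqP->//|h]; rewrite 5!inE h !orbT.
Qed.

Lemma slots_sub : {subset mods (For xj e_slots p_chain) <=
  [:: xj, xq, xw, xl, xtot, xsum & move_vars]}.
Proof.
move=> y; rewrite -[mods _]/(xj :: mods p_chain ++ [:: xj]) inE mem_cat mem_seq1.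
by case/or3P => [/eqP->|/mods_p_chain h|/eqP->]; rewrite ?mem_head // inE h orbT.
Qed.

Lemma slots_runs s : s xn 0 = n%:Z -> (forall i, s xcert i = load cert i) ->
  s xlen 0 = digits%:Z -> chain_state 0 s ->
  runs (For xj e_slots p_chain) s (chain_state (slots k n)).
Proof.
move=> sn sc sl st.
have sub : {subset xj :: mods p_chain <= [:: xj, xq, xw, xl, xtot, xsum & move_vars]}.
  by move=> y; rewrite inE => /orP[/eqP->//|/mods_p_chain h]; rewrite inE h orbT.
apply: runs_weaken (@runs_for _ _ _ f b xj e_slots p_chain (slots k n) chain_state
  s slotsb _ _ _ _) _.
- by apply/negP => /mods_p_chain.
- by case: st => h1 h2 h3; split=> // i z iN; rewrite upd_other // h3.
- move=> j s' _ /(agree_sub sub) ag _ _; by apply: eval_slots; rewrite ag.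
- move=> j s' jN /(agree_sub sub) ag sj st'.
  apply: runs_weaken (chain_runs jN _ _ _ sj st') _.
  + by rewrite ag.
  + by move=> i; rewrite ag.
  + by rewrite ag.
  + move=> s2 _ [h1 h2 h3]; split=> // i z iN; by rewrite upd_other // h3.
- by move=> s' _ [].
Qed.

Definition amin (i : nat) : int :=
  accv (slots k n) i [arg min_(z < DBot) accv (slots k n) i z]%O.

Lemma amin_le i z : amin i <= accv (slots k n) i z.
Proof. by rewrite /amin; case: arg_minP => // z' _; apply. Qed.

Lemma amin_unique i x : (exists z, x = accv (slots k n) i z) ->
  (forall z, x <= accv (slots k n) i z) -> x = amin i.
Proof.
move=> [z ->] h; apply/eqP; rewrite eq_le amin_le andbT; exact: h.
Qed.

Definition bound_sum (i : nat) : int := base_sum (slots k n) + \sum_(i' < i) amin i'.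

Lemma acc_abs i z : `|accv (slots k n) i z| <= (2 ^ b)%N%:Z.
Proof. by apply: le_trans (accv_abs _ _ _) _; rewrite lez_nat accsb. Qed.

Lemma bound_sum_abs i : (i <= n)%N -> `|bound_sum i| <= (2 ^ b)%N%:Z.
Proof.
move=> iN; apply: le_trans (ler_normD _ _) _.
apply: le_trans (lerD (base_sum_abs _) (ler_norm_sum _ _ _)) _.
apply: le_trans (_ : (slots k n * (Ymax * F))%N%:Z +
    \sum_(i' < i) (slots k n * (len * (Ymax * (2 * F))))%N%:Z <= _).
  by rewrite lerD2l; apply: ler_sum => i' _; exact: accv_abs.
rewrite sumr_const card_ord -mulr_natr natz -PoszM -PoszD lez_nat.
by apply: leq_trans sumsb; rewrite leq_add2l mulnC leq_mul2r iN orbT.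
Qed.

Lemma mods_each_min : {subset mods (each p_min (enum {: D})) <= [:: xmin]}.
Proof. by apply: mods_each => z y. Qed.

Lemma mods_p_minimum : {subset mods p_minimum <= [:: xmin; xsum]}.
Proof.
move=> y; rewrite -[mods _]/(xmin :: mods (each p_min (enum {: D})) ++ [:: xsum]).
by rewrite inE mem_cat => /or3P[/eqP->|/mods_each_min|]; rewrite // inE => /eqP->.
Qed.

Lemma minima_runs s : s xn 0 = n%:Z -> chain_state (slots k n) s ->
  runs p_minima s (fun s' => s' xsum 0 = bound_sum n).
Proof.
move=> sn [_ ss sa].
have sub : {subset xi :: mods p_minimum <= [:: xi; xmin; xsum]}.
  by move=> y; rewrite inE => /orP[/eqP->//|/mods_p_minimum h]; rewrite inE h orbT.
apply: runs_weaken (@runs_for _ _ _ f b xi (var xn) p_minimum n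
  (fun i s' => s' xsum 0 = bound_sum i) s nb _ _ _ _) _.
- by apply/negP => /mods_p_minimum.
- by rewrite upd_other // ss /bound_sum big_ord0 addr0.
- by move=> i s' _ /(agree_sub sub) ag _ _; rewrite /= ag.
- move=> i s' iN /(agree_sub sub) ag si sE; apply: runs_seq.
  have accE z : s' xacc (i * K + rk z)%N%:Z = accv (slots k n) i z by rewrite ag // sa.
  have initE : eval s' (Get xacc (e_acc DBot)) = accv (slots k n) i DBot.
    by have /= := eval_acc DBot si => ->; rewrite accE.
  apply: runs_set; rewrite initE; first exact: acc_abs.
  set s1 := upd _ _ _ _; apply: runs_seq.
  apply: runs_weaken (@runs_each _ _ _ f b _ p_min (enum {: D}) (fun l1 s2 =>
    (exists z, s2 xmin 0 = accv (slots k n) i z) /\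
    forall z, z \in l1 -> s2 xmin 0 <= accv (slots k n) i z) s1 _ _) _.
  + by split=> //; exists DBot.
  + move=> l1 z l2 s2 _ /(agree_sub mods_each_min) ag2 [[z0 z0E] le2].
    have si2 : s2 xi 0 = i%:Z by rewrite ag2.
    have newE : eval s2 (var xmin +e (Get xacc (e_acc z) -e var xmin) *e
        (Get xacc (e_acc z) <=e var xmin)) =
        if accv (slots k n) i z <= s2 xmin 0 then accv (slots k n) i z else s2 xmin 0.
      have /= := eval_acc z si2 => ->; rewrite (ag2 xacc) // /s1 upd_other // accE.
      by case: ifP => _; rewrite ?mulr1 ?mulr0 ?addr0 // addrC subrK.
    apply: runs_set; rewrite newE; first by case: ifP => _; rewrite ?z0E; exact: acc_abs.
    rewrite /= upd_same; split.
      by case: ifP => _; [exists z | exists z0].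
    move=> z1; rewrite mem_rcons inE => /orP zz1.
    by case: (leP (accv (slots k n) i z)) => h; case: zz1 => [/eqP->|/le2] //; [exact: le_trans | rewrite ltW].
  + move=> s2 /(agree_sub mods_each_min) ag2 [exz lez].
    have mE : s2 xmin 0 = amin i.
      by apply: amin_unique => // z; apply: lez; rewrite mem_enum.
    have sumE : eval s2 (var xsum +e var xmin) = bound_sum i.+1.
      rewrite /= mE ag2 // /s1 upd_other // sE /bound_sum big_ord_recr /= addrA.
      by [].
    apply: runs_set; rewrite sumE; first exact: bound_sum_abs.
    by rewrite upd_other // upd_same.
- by move=> s' _ [].
Qed.

Definition accepting : bool :=
  [&& load (int_bits m) (digits + 1)%N%:Z == -1,
      (1 - 2 * load (int_bits m) 0) * (`|m| %% 2 ^ digits)%N%:Z == f goal_pt &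
      (tot (slots k n))%:Z * ((1 - 2 * load (int_bits m) 0) *
        (`|m| %% 2 ^ digits)%N%:Z - 1) + 1 <= bound_sum n].

Lemma minima_sub : {subset mods p_minima <= [:: xi; xmin; xsum]}.
Proof.
move=> y; rewrite -[mods _]/(xi :: mods p_minimum ++ [:: xi]) inE mem_cat mem_seq1.
by case/or3P => [/eqP->//|/mods_p_minimum h|/eqP->//]; rewrite inE h orbT.
Qed.

Lemma verifier_runs :
  runs verifier (init_memory n m cert) (fun s' => s' xn 0 = (nat_of_bool accepting)%:Z).
Proof.
set s0 := init_memory n m cert.
apply: runs_seq; apply: runs_weaken (@precision_runs s0 _ _ _) _ => //.
move=> s1 ag1 l1; apply: runs_seq.
apply: runs_weaken (@target_runs s1 _ _ _ l1) _.
- by rewrite ag1.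
- by move=> i; rewrite ag1.
- by move=> i; rewrite ag1.
move=> s2 ag2 [v2 t2]; apply: runs_seq.
have l2 : s2 xlen 0 = digits%:Z by rewrite ag2.
apply: runs_weaken (@slots_runs s2 _ _ l2 _) _.
- by rewrite ag2 // ag1.
- by move=> i; rewrite ag2 // ag1.
- split; first by rewrite ag2 // ag1 // /tot big_ord0.
    by rewrite ag2 // ag1 // /base_sum big_ord0.
  by move=> i z _; rewrite ag2 // ag1 // /accv big_ord0.
move=> s3 /(agree_sub slots_sub) ag3 st3; apply: runs_seq.
have s3n : s3 xn 0 = n%:Z by rewrite ag3 // ag2 // ag1.
apply: runs_weaken (minima_runs s3n st3) _.
move=> s4 /(agree_sub minima_sub) ag4 sum4.
have mE i : s4 xm i = load (int_bits m) i by rewrite ag4 // ag3 // ag2 // ag1.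
have outE : eval s4 ((Get xm (var xlen +e cst 1) =e cst (-1)) *e (e_target =e var xft) *e
         (var xtot *e (e_target -e cst 1) +e cst 1 <=e var xsum)) =
    (nat_of_bool accepting)%:Z.
  have h1 : s4 xlen 0 = digits%:Z by rewrite ag4 // ag3.
  have h2 : s4 xval 0 = (`|m| %% 2 ^ digits)%N%:Z by rewrite ag4 // ag3.
  have h3 : s4 xft 0 = f goal_pt by rewrite ag4 // ag3.
  have h4 : s4 xtot 0 = (tot (slots k n))%:Z by rewrite ag4 //; case: st3.
  rewrite /= !mE h1 h2 h3 h4 sum4 -PoszD /accepting.
  by case: (_ == -1) => //=; case: (_ == f _) => //=; rewrite ?mul1r ?mul0r.
apply: runs_set; rewrite outE; last by rewrite upd_same.
by apply: natb; case: accepting => //; exact: leq_trans nb.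
Qed.
End Run.
End Verifier.

(** * Acceptance characterises the minimum *)

Section Acceptance.
Variables (k n : nat) (n_gt0 : (0 < n)%N).
Local Notation D := (diamond k).
Local Notation Ln := (n.-tupleprod D).
Variable f : Ln -> int.
Hypothesis fsub : submodular f.

Lemma load_int_bits_end (m : int) d :
  (load (int_bits m) (d + 1)%N%:Z == -1) = (bitlen m <= d)%N.
Proof.
rewrite addn1 -[LHS]/(nth (-1) [seq (nat_of_bool x)%:Z |
  x <- mkseq (fun i => odd (`|m| %/ 2 ^ i)) (bitlen m)] d == -1).
have [h|h] := leqP (bitlen m) d.
  by rewrite nth_default // size_map size_mkseq.
by rewrite (nth_map false) ?size_mkseq //; case: (nth _ _ _).
Qed.

(** Once the length of [m] is known to be at most [digits], reading it modulo [2 ^ digits] loses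
    nothing. *)
Lemma acceptingE m cert : accepting n_gt0 f m cert =
  [&& (bitlen m <= digits f cert)%N, m == f (goal_pt k n cert)
    & (tot f cert (slots k n))%:Z * (m - 1) + 1 <= bound_sum n_gt0 f cert n].
Proof.
rewrite /accepting load_int_bits_end; case: leqP => //= h.
suff -> : (1 - 2 * load (int_bits m) 0) * (`|m| %% 2 ^ digits f cert)%N%:Z = m by [].
rewrite modn_small; last by apply: leq_trans (bitlen_gt m) _; rewrite leq_exp2l.
by rewrite /load /=; case: (ltP m 0) => hm /=; lia.
Qed.

(** Regroups the moves of every chain by the coordinate they raise. *)
Lemma chain_sum_split cert t :
  base_sum f cert (slots k n) + \sum_(i < n) accv n_gt0 f cert (slots k n) i (tnth t i) =
  \sum_(j < slots k n) (wt f cert j)%:Z * chain_value n_gt0 f (mv k n cert j) t.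
Proof.
rewrite /accv exchange_big /= -big_split /=; apply: eq_bigr => j _.
rewrite -mulr_sumr -mulrDr; congr (_ * (_ + _)).
rewrite (partition_big (fun q : 'I_(moves n + n) => coord n_gt0 q) predT) //=.
apply: eq_bigr => i _; rewrite /hsum /len.
by apply: eq_big => [q|q /eqP qi]; rewrite -?(inj_eq val_inj) //; congr gain; congr tnth; apply: val_inj.
Qed.

(** If [f t <= m - 1], the weighted bound at [t] is at most [tot * (m - 1)], against the last test.
    Arbitrary weights are harmless: with total weight 0 the test already fails. *)
Lemma accepting_minimum m cert : accepting n_gt0 f m cert -> is_minimum f m.
Proof.
rewrite acceptingE => /and3P[_ /eqP mE bnd]; split; first by exists (goal_pt k n cert).
move=> t; rewrite leNgt; apply/negP => ftm.
have : (tot f cert (slots k n))%:Z * (m - 1) + 1 <= (tot f cert (slots k n))%:Z * f t.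
  apply: le_trans bnd _.
  apply: le_trans (_ : base_sum f cert (slots k n) +
    \sum_(i < n) accv n_gt0 f cert (slots k n) i (tnth t i) <= _).
    by rewrite lerD2l; apply: ler_sum => i _; exact: amin_le.
  rewrite chain_sum_split /tot -natz natr_sum mulr_suml; apply: ler_sum => j _.
  rewrite natz ler_wpM2l //; apply: chain_value_le => // q.
  by rewrite /mv ltnNge => ->.
by have : 0 <= (tot f cert (slots k n))%:Z by []; move: ftm; nia.
Qed.

Lemma tupf_nth (t : Ln) : tupf n (fun i => nth DBot t i) = t.
Proof. by apply: eq_from_tnth => i; rewrite tnth_mktuple -tnth_nth. Qed.

Lemma minimum_accepting m : is_minimum f m -> exists cert, accepting n_gt0 f m cert.
Proof.
move=> [[t0 t0m] mf].
(* The number of digits grows with [|f|] at the precision point, so a point maximising [|f|]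
   provides enough of them. *)
pose t1 := [arg max_(t > t0) `|f t|%N]%O.
have t1max t : (`|f t| <= `|f t1|)%N.
  by rewrite /t1; case: arg_maxP => // t2 _ /(_ t isT).
set F := `|f t1|%N.
pose Lv := (trunc_log 2 (cap_of k n F)).+1.
have capL : (cap_of k n F < 2 ^ Lv)%N by exact: trunc_log_ltn.
(* Weights at most [2 ^ Lv - 1] are exactly those with [Lv] digits. *)
have [|||V [W [WP Vtop VW]]] := @certificate_exists k n n_gt0 f fsub m F (2 ^ Lv).-1 mf.
- by rewrite -t0m -abszE lez_nat t1max.
- by move=> t; rewrite -abszE lez_nat t1max.
- rewrite -ltnS prednK ?expn_gt0 //; apply: leq_trans capL; rewrite ltnS /cap_of -/(len n).
  move: (slots k n) (len n) => a l.
  have FF : (F <= F * F)%N by case: (F) => // F'; rewrite leq_pmulr.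
  apply: leq_trans (_ : (1 + F) * (a * (2 * l + 3) + 1) <= _)%N.
    by nia.
  by rewrite leq_mul2r; apply/orP; right; rewrite leq_add2l.
pose w q : D := let x := (q %/ 4)%N in
  match (q %% 4)%N with
  | 0 => nth DBot t0 x
  | 1 => nth DBot t1 x
  | 2 => if odd (W (x %/ Lv)%N %/ 2 ^ (Lv - (x %% Lv).+1)) then DTop else DBot
  | _ => V (x %/ len n)%N (x %% len n)%N
  end.
have dec x r : (r < 4)%N -> ((4 * x + r) %/ 4 = x)%N /\ ((4 * x + r) %% 4 = r)%N.
  by move=> r4; split; lia.
have [cert certP] := words_exist w (4 * (n + slots k n * Lv + slots k n * len n).+1)%N.
have wE x r : (r < 4)%N -> (x <= n + slots k n * Lv + slots k n * len n)%N ->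
    word_elt k cert (4 * x + r) = w (4 * x + r)%N.
  by move=> r4 xN; apply: certP; lia.
have precE : prec_pt k n cert = t1.
  rewrite -[RHS]tupf_nth; apply: eq_from_tnth => i; rewrite !tnth_mktuple.
  rewrite wE //; last by have := ltn_ord i; lia.
  by rewrite /w; have [-> ->] := @dec i 1%N isT.
have goalE : goal_pt k n cert = t0.
  rewrite -[RHS]tupf_nth; apply: eq_from_tnth => i; rewrite !tnth_mktuple.
  rewrite -[(4 * i)%N]addn0 wE //; last by have := ltn_ord i; lia.
  by rewrite /w; have [-> ->] := @dec i 0%N isT.
have digE : digits f cert = Lv by rewrite /digits /cap precE.
have wtE j : (j < slots k n)%N -> wt f cert j = W j.
  move=> jN; rewrite /wt digE -[RHS](@modn_small _ (2 ^ Lv)); last first.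
    by have := WP j; have := expn_gt0 2 Lv; lia.
  rewrite -hor_digits; apply: eq_hor => l lL.
  have jl : (j * Lv + l <= n + slots k n * Lv + slots k n * len n)%N by nia.
  rewrite wE // /w; have [-> ->] := @dec (j * Lv + l)%N 2%N isT.
  by rewrite divnMDl // (divn_small lL) addn0 modnMDl (modn_small lL); case: (odd _).
have mvE j : (j < slots k n)%N -> mv k n cert j =1 V j.
  move=> jN q; rewrite /mv; case: ltnP => qm; last by rewrite Vtop.
  have ql : (q < len n)%N by rewrite /len; lia.
  have jq : (j * len n + q <= n + slots k n * Lv + slots k n * len n)%N by nia.
  rewrite wE // /w; have [-> ->] := @dec (j * len n + q)%N 3%N isT.
  by rewrite divnMDl ?(leq_ltn_trans _ ql) // (divn_small ql) addn0 modnMDl (modn_small ql).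
exists cert; rewrite acceptingE; apply/and3P; split.
- rewrite digE; apply: bitlen_le; apply: leq_trans capL; rewrite ltnS -t0m.
  apply: leq_trans (t1max t0) _; rewrite -/F /cap_of addn1.
  by apply: leq_trans (_ : (1 + F * F) * 1 <= _)%N; [case: (F) => // F'; nia | rewrite leq_mul2l].
- by rewrite goalE t0m.
(* Coordinatewise minimisers: at this point the separable bound attains [bound_sum], so the strict
   inequality for all points gives the last test. *)
pose tmin : Ln := [tuple [arg min_(z < DBot) accv n_gt0 f cert (slots k n) i z]%O | i < n].
have lt_m := VW tmin.
have -> : bound_sum n_gt0 f cert n =
    \sum_(j < slots k n) (wt f cert j)%:Z * chain_value n_gt0 f (mv k n cert j) tmin.
  rewrite -chain_sum_split; congr (_ + _); apply: eq_bigr => i _.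
  by rewrite tnth_mktuple.
have -> : tot f cert (slots k n) = (\sum_(j < slots k n) W j)%N.
  by apply: eq_bigr => j _; rewrite wtE.
rewrite [X in _ <= X](eq_bigr (fun j : 'I__ => (W j)%:Z * chain_value n_gt0 f (V j) tmin)).
  by rewrite lezD1.
move=> j _; rewrite wtE //; congr (_ * (_ + _)); apply: eq_bigr => q _.
by apply: eq_gain; apply: mvE.
Qed.

End Acceptance.

(** * The polynomial time bound *)

Lemma load_abs c i : `|load c i| <= 1.
Proof.
case: i => // i; rewrite /load; have [h|h] := ltnP i (size c).
  by rewrite (nth_map false) //; case: (nth _ _ _).
by rewrite nth_default // size_map.
Qed.

Definition polyfun (g : nat -> nat -> nat) : Prop :=
  exists p : {poly {poly nat}}, forall n M, p.[n%:P].[M] = g n M.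

Lemma polyfun_const c : polyfun (fun _ _ => c).
Proof. by exists c%:P%:P => n M; rewrite !hornerC. Qed.

Lemma polyfun_fst : polyfun (fun n _ => n).
Proof. by exists 'X => n M; rewrite hornerX hornerC. Qed.

Lemma polyfun_snd : polyfun (fun _ M => M).
Proof. by exists 'X%:P => n M; rewrite hornerC hornerX. Qed.

Lemma polyfun_add g h : polyfun g -> polyfun h -> polyfun (fun n M => g n M + h n M)%N.
Proof.
by move=> [p pE] [q qE]; exists (p + q) => n M; rewrite !hornerD pE qE.
Qed.

Lemma polyfun_mul g h : polyfun g -> polyfun h -> polyfun (fun n M => g n M * h n M)%N.
Proof.
by move=> [p pE] [q qE]; exists (p * q) => n M; rewrite !hornerM pE qE.
Qed.

Lemma eq_polyfun g h : (forall n M, g n M = h n M) -> polyfun g -> polyfun h.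
Proof. by move=> gh [p pE]; exists p => n M; rewrite pE. Qed.

(** For a fixed program the bound is a polynomial in [b], of degree at most the nesting depth of its
    loops. *)
Lemma polyfun_tbound c b : polyfun b -> polyfun (fun n M => tbound (b n M) c).
Proof.
move=> pb; elim: c => [|x e1 e2|c1 IH1 c2 IH2|e c1 IH1 c2 IH2|e c IH|x a] /=;
  do ?[exact: polyfun_const | exact: pb | exact: IH1 | exact: IH2 | exact: IH
      | apply: polyfun_add | apply: polyfun_mul].
Qed.

Section Bound.
Variable k : nat.

(** An exponent [b] for the cell bound [2 ^ b]. The product to be dominated turns into a sum of
    exponents, which is linear in [M] for fixed [n] because [f] enters only through powers of
    two. *)
Definition size_bound (n M : nat) : nat :=
  (#|{: diamond k}| + n.+1 + slots k n + (len n).+1 +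
   (1 + (2 * M + 3) + (slots k n * (2 * len n + 3) + 1)) + (M + 3))%N.

Lemma polyfun_size_bound : polyfun size_bound.
Proof.
pose s n := (n * #|{: diamond k}| + 1)%N; pose l n := (n * 2 * n + n)%N.
have ps : polyfun (fun n _ => s n).
  by do ?[exact: polyfun_const | exact: polyfun_fst | apply: polyfun_add | apply: polyfun_mul].
have pl : polyfun (fun n _ => l n).
  by do ?[exact: polyfun_const | exact: polyfun_fst | apply: polyfun_add | apply: polyfun_mul].
apply: (@eq_polyfun (fun n M => #|{: diamond k}| + (n + 1) + s n + (l n + 1) +
   (1 + (2 * M + 3) + (s n * (2 * l n + 3) + 1)) + (M + 3))%N).
  move=> n M; rewrite /size_bound !addn1 /slots /s /l /len /moves !addn1 muln2.
  by [].
by do ?[exact: polyfun_const | exact: polyfun_fst | exact: polyfun_snd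
  | exact: ps | exact: pl | apply: polyfun_add | apply: polyfun_mul].
Qed.

Lemma size_bound_ok n M (F := (2 ^ M.+1)%N) (b := size_bound n M) :
  (#|{: diamond k}| * n.+1 * slots k n * (len n).+1 * Ymax k n F * (2 * F).+1
   <= 2 ^ b)%N.
Proof.
have e2 x : (x <= 2 ^ x)%N by apply: ltnW; exact: ltn_expl.
have F2 : ((2 * F).+1 <= 2 ^ (M + 3))%N.
  rewrite /F -expnS addnC -addn1 expnD; have := expn_gt0 2 M.
  by rewrite !expnS expn0 /=; lia.
have mulX x y u v : (x <= 2 ^ u -> y <= 2 ^ v -> x * y <= 2 ^ (u + v))%N.
  by rewrite expnD; exact: leq_mul.
apply: (mulX _ _ _ _ _ F2); apply: (mulX); first by do 3![apply: (mulX) => //].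
rewrite /Ymax /cap_of mulnA; apply: (mulX) => //; apply: (mulX) => //.
rewrite /F -expnD addnn; have -> : (2 * M + 3 = (M.+1).*2.+1)%N by lia.
by rewrite expnS; have := expn_gt0 2 (M.+1).*2; lia.
Qed.

End Bound.

Theorem theorem4 (k : nat) (hk : (3 <= k)%N) : well_characterised (diamond k).
Proof.
have [p pE] : polyfun (fun n M =>
    tbound (size_bound k n M) (verifier k) * (size_bound k n M).+1)%N.
  apply: polyfun_mul; first exact/polyfun_tbound/polyfun_size_bound.
  apply: (@eq_polyfun (fun n M => size_bound k n M + 1)%N) => [n M|]; first by rewrite addn1.
  by apply: polyfun_add; [exact: polyfun_size_bound | exact: polyfun_const].
exists (verifier k), p => n f n_gt0 fsub.
pose M := max_log f; pose b := size_bound k n M.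
have Ff t : `|f t| <= (2 ^ M.+1)%N%:Z.
  rewrite -abszE lez_nat; apply: leq_trans (ltnW (bitlen_gt (f t))) _.
  by rewrite leq_exp2l // ltnS; apply: (leq_bigmax (F := fun t => trunc_log 2 `|f t|%N)).
(* A single timed run yields termination, the time bound and the answer; determinism of [exec] then
   identifies it with any accepting run. *)
have run m cert : exists s T, [/\ exec f (verifier k) (init_memory n m cert) s T,
    (T <= p.[n%:P].[M])%N & s 0%N 0 = (nat_of_bool (accepting n_gt0 f m cert))%:Z].
  have nb : (n <= b)%N by rewrite /b /size_bound; lia.
  have [||||s [T [e hT _ out]]] := @verifier_runs k n n_gt0 f m cert (2 ^ M.+1)%N b Ff nb.
  - by rewrite /b /size_bound; lia.
  - by rewrite /b /size_bound; lia.
  - exact: size_bound_ok.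
  - have b1 : (1 : int) <= (2 ^ b)%N by rewrite lez_nat expn_gt0.
    move=> [|[|[|x]]] i //=; last exact: le_trans (load_abs _ _) _.
      case: ifP => _ //; rewrite lez_nat; apply: leq_trans nb _; apply: ltnW; exact: ltn_expl.
    exact: le_trans (load_abs _ _) _.
  by exists s, T; rewrite pE.
have acc m cert : accepts (verifier k) f m cert <-> accepting n_gt0 f m cert.
  have [s [T [e _ out]]] := run m cert; split.
    move=> [s' [T' [e' out']]]; have [ss _] := exec_det e e'.
    by move: out; rewrite ss out'; case: accepting.
  by move=> h; exists s, T; split=> //; rewrite out h.
split=> [m cert|m mmin|m [cert /acc h]].
- by have [s [T [e hT _]]] := run m cert; exists s, T.
- by have [cert h] := minimum_accepting n_gt0 fsub mmin; exists cert; apply/acc.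
- exact: accepting_minimum h.
Qed.
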